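(* Let $\mathbb{X}$ be a metric space, $\varpi$ a positive finite measure on $\mathbb{X}$, $\mu=\varpi\times\varpi$ the corresponding product measure on $\mathbb{X}^2$, and $\mathcal{E}=\mathbb{R}$, $\mathbb{R}_{\geq0}$ or $\mathbb{R}_{\leq0}$. A continuous function $\rho:\mathbb{X}\times\mathbb{X}\to\mathbb{R}$ is the non-centered covariance of a random field on $\mathbb{X}$ with values in $\mathcal{E}$ if, and only if, it fulfills the following conditions: 1. Symmetry: $\rho(x,y)=\rho(y,x)$ for any $x,y\in\mathbb{X}$. 2. Gap inequalities: for any symmetric continuous function $\lambda:\mathbb{X}\times\mathbb{X}\to\mathbb{R}$, $$\int_{\mathbb{X}^2}\lambda(x,y)\,\rho(x,y)\,\mathrm{d}\mu(x,y)\ \geq\ \gamma(\lambda,\mathcal{E},\mu).$$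
   Context: ''Positive'' measure is used in the paper as opposed to merely non-negative: a measure such as a finite sum of Dirac measures, vanishing on the complement of a finite set, is regarded as non-negative but not positive. A random field on $\mathbb{X}$ valued in $\mathcal{E}$ is a collection $Z=\{Z(x,\cdot):x\in\mathbb{X}\}$ of $\mathcal{E}$-valued random variables on a same probability space; when every $Z(x,\cdot)$ is square integrable, its non-centered covariance is $\rho(x,y)=\mathbb{E}[Z(x,\cdot)Z(y,\cdot)]$. The $\gamma$-gap of a function $\lambda$ on $\mathcal{E}$ is $$\gamma(\lambda,\mathcal{E},\mu)=\inf\Big\{\int_{\mathbb{X}^2}\lambda(x,y)\,z(x)\,z(y)\,\mathrm{d}\mu(x,y):z\in\mathcal{E}^{\mathbb{X}},\ \|\varphi_z\|_\mu<+\infty\Big\},$$ where $\varphi_z(x,y)=z(x)z(y)$ and $\|f\|_\mu=(\int_{\mathbb{X}^2}f^2\,\mathrm{d}\mu)^{1/2}$. (In the paper the gap is defined for $\lambda\in L^2(\mathbb{X}^2,\mu)$.) *)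

(* Defs.v *)
From HB Require Import structures.
From mathcomp Require Import all_boot all_order all_algebra.
From mathcomp Require Import all_classical all_reals all_analysis.

Set Implicit Arguments.
Unset Strict Implicit.
Unset Printing Implicit Defensive.

Import Order.TTheory GRing.Theory Num.Theory.
Import numFieldNormedType.Exports.

Local Open Scope classical_set_scope.
Local Open Scope ring_scope.

(* The base point is there only because the library's measurable types are
   pointed; no definition below refers to it. *)
#[short(type="pmetricType")]
HB.structure Definition PointedMetric (K : numDomainType) :=
  { T of Metric K T & Pointed T }.

Definition borel (R : realType) (X : pmetricType R) :=
  g_sigma_algebraType (@open X).

(* Positivity is strict: every nonempty open set is charged. On an infinite
   metric space this rules out every measure carried by a finite set. *)
Definition positive_measure (R : realType) (X : pmetricType R)
    (w : {measure set (borel X) -> \bar R}) : Prop :=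
  forall U : set X, open U -> U !=set0 -> (0 < w U)%E.

Definition symmetric_kernel (T S : Type) (f : T * T -> S) : Prop :=
  forall x y, f (x, y) = f (y, x).

Definition tensor_sq (R : realType) (T : Type) (z : T -> R) : T * T -> R :=
  fun p => z p.1 * z p.2.

(* Membership of [tensor_sq z] in [Lfun mu 2] is finiteness of its L^2 norm
   together with the measurability under which that norm makes sense. For
   lam in L^2(mu) all the integrals below are absolutely convergent; the gap
   is only meaningful, and only used, for such lam. *)
Definition gap (R : realType) (d : measure_display) (T : measurableType d)
    (lam : T * T -> R) (E : set R) (mu : {measure set (T * T) -> \bar R})
    : \bar R :=
  ereal_inf
    [set (\int[mu]_p (lam p * tensor_sq z p)%:E)%E | z in
      [set z : T -> R |
        (forall x, E (z x)) /\ tensor_sq z \in Lfun mu 2%:E]].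

(* Random variables X -> (Omega -> R) on a common probability space, each of
   them valued in E everywhere. *)
Definition random_field (R : realType) (X : Type) (E : set R)
    (d : measure_display) (Omega : measurableType d) (P : probability Omega R)
    (Z : X -> {RV P >-> R}) : Prop :=
  forall x omega, E (Z x omega).

Definition noncentered_covariance (R : realType) (X : Type)
    (d : measure_display) (Omega : measurableType d) (P : probability Omega R)
    (Z : X -> {RV P >-> R}) (rho : X * X -> R) : Prop :=
  (forall x, (Z x : Omega -> R) \in Lfun P 2%:E) /\
  (forall x y, 'E_P[fun omega => (Z x omega * Z y omega)%R]%E =
               (rho (x, y))%:E).

Definition is_noncentered_covariance (R : realType) (X : Type) (E : set R)
    (rho : X * X -> R) : Prop :=
  exists (d : measure_display) (Omega : measurableType d)
         (P : probability Omega R) (Z : X -> {RV P >-> R}),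
    random_field E Z /\ noncentered_covariance Z rho.

(* The integral of f exists in [-oo, +oo]: its positive and negative parts are
   not both of infinite integral. *)
Definition integral_exists (R : realType) (d : measure_display)
    (T : measurableType d) (mu : {measure set T -> \bar R}) (f : T -> \bar R)
    : Prop :=
  (\int[mu]_x f^\+ x +? - (\int[mu]_x f^\- x))%E.

(* As X need not be compact, lam ranges over the symmetric continuous kernels
   for which both sides are defined: lam in L^2(mu) for the gap, existence of
   the integral of lam * rho for the other side. Both hold for every continuous
   lam when X is compact. *)
Definition gap_inequalities (R : realType) (X : pmetricType R) (E : set R)
    (mu : {measure set (borel X * borel X) -> \bar R}) (rho : X * X -> R)
    : Prop :=
  forall lam : X * X -> R,
    continuous lam -> symmetric_kernel lam ->
    (lam : borel X * borel X -> R) \in Lfun mu 2%:E ->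
    integral_exists mu (fun p => (lam p * rho p)%:E) ->
    (gap (lam : borel X * borel X -> R) E mu
       <= \int[mu]_p (lam p * rho p)%:E)%E.

(* Main.v *)
Require Import Defs.
From HB Require Import structures.
From mathcomp Require Import all_boot all_order all_algebra.
From mathcomp Require Import all_classical all_reals all_analysis.
From mathcomp Require Import measurable_realfun.
From mathcomp Require Import ring lra.
Import Order.TTheory GRing.Theory Num.Theory.
Import numFieldNormedType.Exports.
Local Open Scope classical_set_scope.
Local Open Scope ring_scope.

(* Both directions rest on [X] being separable: [w] is finite and charges every
   ball. As [E] is a cone, the gap of a kernel is [0] or [-oo], so the gap
   inequalities say that [rho] is nonnegative on the kernels [lam] whose
   quadratic form is nonnegative on [E]-valued functions.

   Necessity. Replacing points by their nearest neighbours among finitely many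
   points of a dense sequence turns the integral of [lam * rho] into a finite
   quadratic form evaluated at the covariance, that is, the expectation of a
   nonnegative quantity; one passes to the limit by dominated convergence where
   [rho] is bounded, then by monotone convergence. No measurable version of the
   random field is needed.

   Sufficiency. Testing against products of bumps shows that every finite
   quadratic form that is nonnegative on [E]-valued vectors is nonnegative at the
   matrix of [rho] on a dense sequence. After a change of weights the vectors
   may be confined to a box, and evaluation at [rho] extends to a positive
   functional on bounded functions; read on binary digits it is a finitely
   additive measure on the clopen subsets of a Cantor space, hence extends to a
   probability, which gives bounded random variables with the right second
   moments. The weights matter: without confinement second moments could escape
   in the limit. The field is extended from the dense sequence to [X] by limits
   in mean square. *)

(** * Positive functionals *)

Definition bounded_real (R : realType) (T : Type) (f : T -> R) : Prop :=
  exists M, forall t, `|f t| <= M.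

Arguments bounded_real {R T} f.

Lemma bounded_real_cst (R : realType) U (c : R) : bounded_real (fun _ : U => c).
Proof. by exists `|c|. Qed.

Lemma bounded_real_lin (R : realType) U (f g : U -> R) a : bounded_real f -> bounded_real g ->
  bounded_real (fun t => f t + a * g t).
Proof.
move=> [M fM] [N gN]; exists (M + `|a| * N) => t.
by rewrite (le_trans (ler_normD _ _))// lerD// normrM ler_wpM2l.
Qed.

Lemma bounded_real_mul (R : realType) T (f g : T -> R) :
  bounded_real f -> bounded_real g -> bounded_real (fun w => f w * g w).
Proof.
by move=> [M fM] [N gN]; exists (M * N) => x; rewrite normrM ler_pM.
Qed.

(* A positive linear functional is handled through its graph, so that partial
   functionals are mere sets and Zorn's lemma applies to inclusion. *)
Definition positive_graph (R : realType) (T : Type) (G : set ((T -> R) * R)) :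
    Prop :=
  [/\ G (cst 1, 1),
      forall f r g s (a : R), G (f, r) -> G (g, s) ->
        G (fun t => f t + a * g t, r + a * s) &
      forall f r, G (f, r) -> (forall t, 0 <= f t) -> 0 <= r].

Arguments positive_graph {R T} G.

Lemma positive_graph_functional (R : realType) (T : Type)
    (G : set ((T -> R) * R)) f r s :
  positive_graph G -> G (f, r) -> G (f, s) -> r = s.
Proof.
move=> [_ Glin Gpos] Gr Gs.
have le_of r1 s1 : G (f, r1) -> G (f, s1) -> s1 <= r1.
  move=> Gr1 Gs1; rewrite -subr_ge0 -(mulN1r s1).
  apply: (Gpos _ _ (Glin _ _ _ _ (-1) Gr1 Gs1)) => t.
  by rewrite mulN1r subrr.
by apply/eqP; rewrite eq_le !le_of.
Qed.

(** The Hahn-Banach step. A value at [h] must lie above the values of the minorants of [h] in the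
    graph and below those of its majorants; the supremum of the former will do. Boundedness of [h]
    supplies constants of both kinds. *)
Lemma positive_graph_extend (R : realType) (T : Type)
    (G : set ((T -> R) * R)) (h : T -> R) :
  positive_graph G -> bounded_real h ->
  exists r, positive_graph
    [set p | exists g s (a : R), G (g, s) /\
       p = (fun t => g t + a * h t, s + a * r)].
Proof.
move=> [G1 Glin Gpos] [M hM].
have Geq f g r s : G (f, r) -> f =1 g -> r = s -> G (g, s).
  by move=> Gf /funext <- <-.
have Gcst (c : R) : G (cst c, c).
  have G0 : G (cst 0, 0).
    by apply: (Geq _ _ _ _ (Glin _ _ _ _ (-1) G1 G1)) => [t|] /=;
      rewrite mulN1r subrr.
  by apply: (Geq _ _ _ _ (Glin _ _ _ _ c G0 G1)) => [t|] /=;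
    rewrite mulr1 add0r.
have Gscale (c : R) g s : G (g, s) -> G (fun t => c * g t, c * s).
  move=> Gg; apply: (Geq _ _ _ _ (Glin _ _ _ _ c (Gcst 0) Gg)) => [t|] /=;
  by rewrite add0r.
have Gmono g s g' s' : G (g, s) -> G (g', s') -> (forall t, g t <= g' t) ->
    s <= s'.
  move=> Gg Gg' gg'; rewrite -subr_ge0 -(mulN1r s).
  apply: (Gpos _ _ (Glin _ _ _ _ (-1) Gg' Gg)) => t.
  by rewrite mulN1r subr_ge0.
pose A := [set s | exists g, G (g, s) /\ forall t, g t <= h t].
have A0 : A !=set0.
  by exists (- M), (cst (- M)); split=> // t; have := hM t; rewrite ler_norml => /andP[].
have Aub g s : G (g, s) -> (forall t, h t <= g t) -> ubound A s.
  move=> Gg hg x [g' [Gg' g'h]]; apply: Gmono Gg' Gg _ => t.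
  exact: le_trans (g'h t) (hg t).
have hsA : has_sup A.
  split=> //; exists M; apply: (Aub (cst M)) => // t.
  by have := hM t; rewrite ler_norml => /andP[].
exists (sup A); split.
- exists (cst 1), 1, 0; split=> //.
  by congr pair; rewrite ?mul0r ?addr0//; apply/funext => t; rewrite mul0r addr0.
- move=> f r g s a [f1 [r1 [b [Gf1 [-> ->]]]]] [g1 [s1 [c [Gg1 [-> ->]]]]].
  exists (fun t => f1 t + a * g1 t), (r1 + a * s1), (b + a * c).
  split; first exact: Glin.
  by congr pair; [apply/funext => t|]; ring.
- move=> f r [g [s [a [Gg [-> ->]]]]] pos.
  (* Division by [a] turns the sign of [g + a * h] into a comparison of [h] with [- a^-1 * g], which
     is a majorant when [a < 0] and a minorant when [a > 0]. *)
  have [a0|a0|a0] := ltgtP a 0.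
  + have : sup A <= - a^-1 * s.
      apply: sup_le_ub => //; apply: (Aub (fun t => - a^-1 * g t)).
        exact: Gscale.
      move=> t; have := pos t; rewrite -(ler_nM2l a0 _ (h t)).
      by rewrite mulrA mulrN divff ?lt_eqF// mulN1r -subr_ge0 opprK addrC.
    rewrite -(ler_nM2l a0) mulrA mulrN divff ?lt_eqF// mulN1r.
    by rewrite -subr_ge0 opprK addrC.
  + have : - a^-1 * s <= sup A.
      apply: ub_le_sup; first exact: hsA.2.
      exists (fun t => - a^-1 * g t); split; first exact: Gscale.
      move=> t; have := pos t; rewrite -(ler_pM2l a0 (- a^-1 * g t)).
      by rewrite mulrA mulrN divff ?gt_eqF// mulN1r -subr_ge0 opprK addrC.
    rewrite -(ler_pM2l a0) mulrA mulrN divff ?gt_eqF// mulN1r.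
    by rewrite -subr_ge0 opprK addrC.
  + rewrite a0 mul0r addr0; apply: Gpos Gg _ => t.
    by have := pos t; rewrite a0 mul0r addr0.
Qed.

Lemma positive_extension (R : realType) (T : Type) (G0 : set ((T -> R) * R)) :
  positive_graph G0 -> (forall f r, G0 (f, r) -> bounded_real f) ->
  exists L : (T -> R) -> R,
  [/\ L (cst 1) = 1,
      forall f g a, bounded_real f -> bounded_real g ->
        L (fun t => f t + a * g t) = L f + a * L g,
      forall f, bounded_real f -> (forall t, 0 <= f t) -> 0 <= L f &
      forall f r, G0 (f, r) -> L f = r].
Proof.
move=> G0P G0b.
(* Taking the union with [G0] inside the property makes the union of the empty chain admissible. *)
pose P (A : set ((T -> R) * R)) := positive_graph (A `|` G0).
have [|A [PA maxA]] := @Zorn_bigcup _ P.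
  move=> F FP Ftot; rewrite /P.
  have chain p q : (\bigcup_(X in F) X `|` G0) p ->
      (\bigcup_(X in F) X `|` G0) q ->
      exists X, [/\ P X, X `<=` \bigcup_(X in F) X,
                    (X `|` G0) p & (X `|` G0) q].
    have inF X : F X -> X `<=` \bigcup_(X in F) X.
      by move=> FX r Xr; exists X.
    move=> [[X FX Xp]|G0p] [[Y FY Yq]|G0q].
    - have [XY|YX] := Ftot _ _ FX FY.
      + by exists Y; split; [exact: FP|exact: inF|left; exact: XY|left].
      + by exists X; split; [exact: FP|exact: inF|left|left; exact: YX].
    - by exists X; split; [exact: FP|exact: inF|left|right].
    - by exists Y; split; [exact: FP|exact: inF|right|left].
    - by exists set0; split; [rewrite /P set0U|exact: sub0set|right|right].
  split.
  - by right; have [] := G0P.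
  - move=> f r g s a pf pg.
    have [X [[_ Xlin _] XF Xf Xg]] := chain _ _ pf pg.
    by have [Xh|G0h] := Xlin _ _ _ _ a Xf Xg; [left; exact: XF|right].
  - move=> f r pf pos; have [X [[_ _ Xpos] _ Xf _]] := chain _ _ pf pf.
    exact: Xpos Xf pos.
set G := A `|` G0 in PA.
have Gbnd h : bounded_real h -> exists r, G (h, r).
  move=> bh; have [r Pr] := positive_graph_extend _ _ _ _ PA bh.
  set Gh := [set p | _] in Pr; exists r.
  have GGh : G `<=` Gh.
    move=> [g s] Gg; exists g, s, 0; split=> //.
    by congr pair; rewrite ?mul0r ?addr0//; apply/funext => t; rewrite mul0r addr0.
  have Ghh : Gh (h, r).
    have [G1 Glin _] := PA.
    have := Glin _ _ _ _ (-1) G1 G1; set f0 := fun _ => _ => Gf0.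
    exists f0, (1 + -1 * 1), 1; split=> //.
    by congr pair; [apply/funext => t; rewrite /f0 /=|]; ring.
  have GhG : Gh `|` G0 = Gh.
    by apply/seteqP; split=> [p [//|G0p]|p]; [apply: GGh; right|left].
  (* A strict inclusion would contradict maximality; otherwise [Gh] is included in [A], which then
     already has a value at [h]. *)
  have [AGh|nAGh] := pselect (A `<` Gh).
    by have := maxA _ AGh; rewrite /P GhG.
  left; move: Ghh; apply: contrapT => nGhA; apply: nAGh; split.
    by apply: subset_trans GGh; left.
  by move=> GhA; apply: nGhA => /GhA.
(* [L] is total; on unbounded functions its value is a placeholder. *)
have /choice [L GL] : forall h, exists r, bounded_real h -> G (h, r).
  move=> h; have [bh|nbh] := pselect (bounded_real h); last by exists 0.
  by have [r] := Gbnd _ bh; exists r.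
have LE f r : bounded_real f -> G (f, r) -> L f = r.
  move=> bf; exact: positive_graph_functional PA (GL _ bf).
have [G1 Glin Gpos] := PA.
exists L; split.
- by apply: LE => //; exists 1 => t /=; rewrite normr1.
- by move=> f g a bf bg; apply: LE; [exact: bounded_real_lin|apply: Glin; exact: GL].
- by move=> f bf; apply: Gpos (GL _ bf).
- by move=> f r G0f; apply: LE; [exact: G0b G0f|right].
Qed.

(** * Probabilities on Cantor spaces *)

(** An alias of [T] on which the clopen sets can be declared as the algebra of sets from which a
    content is extended. *)
Definition clopen_algebra (T : ptopologicalType) : Type := T.

HB.instance Definition _ (T : ptopologicalType) :=
  Pointed.on (clopen_algebra T).

HB.instance Definition _ (T : ptopologicalType) :=
  @isAlgebraOfSets.Build default_measure_display (clopen_algebra T)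
    (@clopen T) (@clopen0 T) (@clopenU T) (fun A => @clopenC T A A).

Section clopen_extension.
Variables (R : realType) (T : ptopologicalType) (nu : set T -> R).
Hypothesis cT : compact [set: T].
Hypothesis nu_ge0 : forall A, 0 <= nu A.
Hypothesis nuU : forall A B, A `&` B = set0 -> nu (A `|` B) = nu A + nu B.
Hypothesis nuT : nu setT = 1.

Definition clopen_content (A : set (clopen_algebra T)) : \bar R := (nu A)%:E.

Let nu0 : nu set0 = 0.
Proof.
have := nuU set0 set0 (setI0 _); rewrite setU0 => /eqP.
by rewrite -subr_eq subrr eq_sym => /eqP.
Qed.

Lemma clopen_content0 : clopen_content set0 = 0%E.
Proof. by rewrite /clopen_content nu0. Qed.

Lemma clopen_content_ge0 A : (0 <= clopen_content A)%E.
Proof. by rewrite lee_fin. Qed.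

(* A clopen set is compact, so that only finitely many members of a clopen
   partition of it are nonempty. *)
Lemma clopen_content_semi_sigma_additive : semi_sigma_additive clopen_content.
Proof.
move=> F mF tF mUF.
have cU : @compact T (\bigcup_n F n).
  by apply: (subclosed_compact mUF.2 cT).
have [N UN] : exists N, \bigcup_n F n `<=` \bigcup_(n < N) F n.
  move: cU; rewrite compact_cover => /(_ nat setT F).
  case; [by move=> i _; have [] := mF i|by []|move=> D _ FD].
  exists (\max_(i <- finmap.enum_fset D) i).+1 => x /FD [i iD Fix].
  by exists i => //=; rewrite ltnS; exact: leq_bigmax_seq.
have F0 n : (N <= n)%N -> F n = set0.
  move=> Nn; apply/eqP/negPn/negP => /set0P[x Fnx].
  have [m /= mN Fmx] : (\bigcup_(n < N) F n) x by apply: UN; exists n.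
  have mn : m = n by apply: tF => //; exists x.
  by move: mN; rewrite mn ltnNge Nn.
have sumE n : (\sum_(0 <= i < n) clopen_content (F i))%E =
              clopen_content (\bigcup_(i < n) F i).
  elim: n => [|n IH].
    by rewrite big_geq// bigcup_mkord big_ord0 clopen_content0.
  rewrite big_nat_recr//= IH /clopen_content -EFinD -nuU.
    by rewrite !bigcup_mkord big_ord_recr.
  apply/eqP/negPn/negP => /set0P[x [[m /= mn Fmx] Fnx]].
  have emn : m = n by apply: tF => //; exists x.
  by move: mn; rewrite emn ltnn.
apply: cvg_near_cst; exists N => // n /= Nn; rewrite sumE.
congr clopen_content; apply/seteqP; split=> x [m _ Fmx]; first by exists m.
exists m => //=; rewrite ltnNge; apply/negP => nm.
by move: Fmx; rewrite F0// (leq_trans Nn).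
Qed.

HB.instance Definition _ := isMeasure.Build _ _ _ clopen_content
  clopen_content0 clopen_content_ge0 clopen_content_semi_sigma_additive.

Definition clopen_probability :
    set (g_sigma_algebraType (@measurable _ (clopen_algebra T))) -> \bar R :=
  measure_extension clopen_content.

HB.instance Definition _ := Measure.on clopen_probability.

Lemma clopen_probabilityE A : clopen A -> clopen_probability A = (nu A)%:E.
Proof.
by move=> cA; rewrite /clopen_probability /measure_extension measurable_mu_extE.
Qed.

Lemma clopen_probabilityT : clopen_probability setT = 1%E.
Proof. by rewrite clopen_probabilityE ?nuT//; exact: clopenT. Qed.

HB.instance Definition _ :=
  Measure_isProbability.Build _ _ _ clopen_probability clopen_probabilityT.

Lemma probability_of_clopen :
  exists P : probability
      (g_sigma_algebraType (@measurable _ (clopen_algebra T))) R,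
    forall A, clopen A -> P A = (nu A)%:E.
Proof. by exists clopen_probability; exact: clopen_probabilityE. Qed.

End clopen_extension.

(** * Binary expansions and random digits *)

Fixpoint dyadic (R : realType) (u : R) (n : nat) : R :=
  if n is m.+1 then
    dyadic R u m + (dyadic R u m + 2 ^- m.+1 <= u)%R%:R * 2 ^- m.+1
  else 0.

Definition bit (R : realType) (u : R) (n : nat) : bool :=
  dyadic R u n + 2 ^- n.+1 <= u.

Definition bit_sum (R : realType) (b : nat -> bool) (n : nat) : R :=
  \sum_(k < n) (b k)%:R * 2 ^- k.+1.

Definition bit_lim (R : realType) (b : nat -> bool) : R := limn (bit_sum R b).

Lemma half_pow (R : realType) n : (2 ^- n : R) = 2 ^- n.+1 + 2 ^- n.+1.
Proof. by rewrite (exprSr _ n) invfM; lra. Qed.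

Lemma half_pow_cvg0 (R : realType) : (fun n => 2 ^- n : R) @ \oo --> 0.
Proof.
rewrite (_ : (fun n => _) = geometric 1 (2^-1)); last first.
  by apply/funext => n; rewrite /geometric /= mul1r exprVn.
by apply: cvg_geometric; rewrite ger0_norm ?invr_ge0// invf_lt1// ltr1n.
Qed.

(** Each new digit selects the half of the current dyadic interval, closed on the left and open on
    the right, that contains [u]. *)
Lemma dyadicP (R : realType) (u : R) n : 0 <= u < 1 ->
  dyadic R u n <= u < dyadic R u n + 2 ^- n.
Proof.
move=> /andP[u0 u1]; elim: n => [|n /andP[l r]] /=.
  by rewrite expr0 invr1 add0r u0.
have [h|h] := leP (dyadic R u n + 2 ^- n.+1) u.
  by rewrite mul1r h/= -addrA -half_pow.
by rewrite mul0r addr0 l h.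
Qed.

Lemma bit_sum_dyadic (R : realType) (u : R) n :
  bit_sum R (bit R u) n = dyadic R u n.
Proof.
elim: n => [|n IH]; first by rewrite /bit_sum big_ord0.
by rewrite /bit_sum big_ord_recr/= -/(bit_sum R (bit R u) n) IH.
Qed.

(** The partial sums increase, and increase by so little that adding [2 ^- n] makes them decrease.
    The bits are arbitrary and may all be ones from some rank on, so the upper bound is not strict,
    unlike in [dyadicP]. *)
Lemma bit_sum_lim (R : realType) (b : nat -> bool) n :
  bit_sum R b n <= bit_lim R b <= bit_sum R b n + 2 ^- n.
Proof.
have step m : bit_sum R b m.+1 = bit_sum R b m + (b m)%:R * 2 ^- m.+1.
  by rewrite /bit_sum big_ord_recr.
have nd : nondecreasing_seq (bit_sum R b).
  apply/nondecreasing_seqP => m; by rewrite step lerDl mulr_ge0.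
have ni : nonincreasing_seq (fun m => bit_sum R b m + 2 ^- m).
  apply/nonincreasing_seqP => m; rewrite step (half_pow _ m).
  rewrite -addrA lerD2l lerD2r -[leRHS]mul1r ler_wpM2r ?invr_ge0 ?exprn_ge0//.
  by case: (b m).
have cv : cvgn (bit_sum R b).
  apply: nondecreasing_is_cvgn => //; exists (bit_sum R b 0 + 2 ^- 0) => _ [m _ <-].
  apply: le_trans (ni _ _ (leq0n m)).
  by rewrite lerDl invr_ge0 exprn_ge0.
apply/andP; split; first exact: nondecreasing_cvgn_le.
apply: limr_le => //; exists n => // m /= nm.
apply: le_trans (ni _ _ nm).
by rewrite lerDl invr_ge0 exprn_ge0.
Qed.

(** The coordinate [(i, k)] is meant for the binary digit of rank [k] of the variable of index
    [i]. *)
Definition bit_space : Type := prod_topology (fun _ : nat * nat => bool).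

HB.instance Definition _ := Pointed.on bit_space.
HB.instance Definition _ := Nbhs.on bit_space.
HB.instance Definition _ := Topological.on bit_space.

Section bit_measure.
Variables (R : realType) (T : Type) (L : (T -> R) -> R) (b : nat * nat -> T -> bool).
Hypothesis L1 : L (cst 1) = 1.
Hypothesis Llin : forall f g a, bounded_real f -> bounded_real g ->
  L (fun t => f t + a * g t) = L f + a * L g.
Hypothesis L_ge0 : forall f, bounded_real f -> (forall t, 0 <= f t) -> 0 <= L f.

Let code (t : T) : bit_space := fun a => b a t.

Let nu (A : set bit_space) : R := L (fun t => \1_A (code t)).

(** [L] applied to indicators pulled back along [code] is finitely additive on clopen sets. The
    events that a coordinate, or two coordinates, equal one are clopen, so the extended probability
    has the prescribed value there. *)
Lemma bit_measure : exists (d : measure_display) (O : measurableType d)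
  (P : probability O R) (B : nat * nat -> O -> bool),
  (forall a, measurable [set o | B a o]) /\
  (forall a c, P ([set o | B a o] `&` [set o | B c o]) =
     (L (fun t => (b a t)%:R * (b c t)%:R))%:E).
Proof.
have bI (A : set bit_space) : bounded_real (fun t => \1_A (code t) : R).
  by exists 1 => t; rewrite indicE; case: (_ \in _); rewrite ?normr1 ?normr0.
have cS : compact [set: bit_space].
  have := @tychonoff _ (fun _ : nat * nat => bool) _ (fun=> bool_compact).
  by congr compact; apply/seteqP; split.
have nu0 A : 0 <= nu A by apply: L_ge0 => // t; rewrite indicE.
have nuT : nu setT = 1 by rewrite /nu indicT.
have nuU A B : A `&` B = set0 -> nu (A `|` B) = nu A + nu B.
  move=> AB; rewrite /nu -[X in _ + X]mul1r -Llin//; congr L; apply/funext => t.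
  rewrite mul1r !indicE in_setU.
  have [tA|tA] := boolP (code t \in A); have [tB|tB] := boolP (code t \in B) => //=;
    rewrite ?addr0 ?add0r//.
  have : (A `&` B) (code t) by split; exact: set_mem.
  by rewrite AB.
have [P PE] := probability_of_clopen _ _ _ cS nu0 nuU nuT.
have cl a : clopen [set o : bit_space | o a].
  rewrite (_ : mkset _ = proj a @^-1` [set true]); last first.
    by apply/seteqP; split.
  apply: preimage_clopen; last exact: proj_continuous.
  by split; [exact: discrete_open|exact: discrete_closed].
exists _, _, P, (fun a o => o a); split=> [a|a c].
  by apply: sub_sigma_algebra; exact: cl.
rewrite PE; last exact: clopenI.
congr (L _)%:E; apply/funext => t; rewrite indicI /= !indicE.
have codeE e : (code t \in [set o : bit_space | o e]) = b e t.
  by apply/idP/idP; rewrite inE.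
by rewrite !codeE.
Qed.
End bit_measure.

Lemma bounded_integrable_fin (R : realType) d (O : measurableType d)
    (mu : {measure set O -> \bar R}) (f : O -> R) :
  (mu setT < +oo)%E ->
  measurable_fun setT f -> bounded_real f -> mu.-integrable setT (EFin \o f).
Proof.
move=> muT mf [M fM]; apply: measurable_bounded_integrable => //.
exists M; split; first by rewrite num_real.
by move=> N MN t _; exact: le_trans (fM t) (ltW MN).
Qed.

Lemma bounded_integrable (R : realType) d (O : measurableType d)
    (P : {finite_measure set O -> \bar R}) (f : O -> R) :
  measurable_fun setT f -> bounded_real f -> P.-integrable setT (EFin \o f).
Proof. by apply: bounded_integrable_fin; rewrite ltey_eq fin_num_measure. Qed.

Lemma Rintegral_probability_cst (R : realType) d (O : measurableType d)
    (P : probability O R) (c : R) : \int[P]_o c = c.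
Proof. by rewrite Rintegral_cst//= probability_setT mulr1. Qed.

(** * From a functional to expectations *)

Section transport.
Variables (R : realType) (T : Type) (L : (T -> R) -> R).
Hypothesis L1 : L (cst 1) = 1.
Hypothesis Llin : forall f g a, bounded_real f -> bounded_real g ->
  L (fun t => f t + a * g t) = L f + a * L g.
Hypothesis L_ge0 : forall f, bounded_real f -> (forall t, 0 <= f t) -> 0 <= L f.
Variables (d : measure_display) (O : measurableType d) (P : probability O R).

(** The relation passes to linear combinations and uniform limits, but not to products: second
    moments have to be obtained from products of two digits. *)
Definition represents (F : O -> R) (f : T -> R) : Prop :=
  [/\ measurable_fun setT F, bounded_real F, bounded_real f &
      \int[P]_o F o = L f].

Lemma represents_cst (c : R) : represents (fun=> c) (fun=> c).
Proof.
split; [exact: measurable_cst|exact: bounded_real_cst|exact: bounded_real_cst|].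
rewrite Rintegral_probability_cst.
have L0 : L (fun=> 0) = 0.
  have E : L (fun=> 0 + 1 * 0) = L (fun=> 0) + 1 * L (fun=> 0).
    by apply: Llin; exact: bounded_real_cst.
  by move: E; rewrite mulr0 addr0 mul1r => /eqP; rewrite -subr_eq subrr eq_sym => /eqP.
have : L (fun=> 0 + c * 1) = L (fun=> 0) + c * L (cst 1).
  by apply: Llin; exact: bounded_real_cst.
by rewrite L0 L1 mulr1 !add0r.
Qed.

Lemma represents_lin F f G g (a : R) : represents F f -> represents G g ->
  represents (fun o => F o + a * G o) (fun t => f t + a * g t).
Proof.
move=> [mF bF bf FE] [mG bG bg GE].
have iF := bounded_integrable _ _ _ P _ mF bF.
have iG := bounded_integrable _ _ _ P _ mG bG.
have maG : measurable_fun setT (fun o => a * G o).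
  by apply: measurable_funM => //; exact: measurable_cst.
have baG : bounded_real (fun o => a * G o).
  have [N gN] := bG; exists (`|a| * N) => t.
  by rewrite normrM ler_wpM2l.
split; [exact: measurable_funD|exact: bounded_real_lin|exact: bounded_real_lin|].
rewrite RintegralD//; last exact: bounded_integrable.
by rewrite RintegralZl// FE GE Llin.
Qed.

Lemma represents_sum n (c : nat -> R) (F : nat -> O -> R) (f : nat -> T -> R) :
  (forall k, represents (F k) (f k)) ->
  represents (fun o => \sum_(k < n) F k o * c k) (fun t => \sum_(k < n) f k t * c k).
Proof.
move=> Ff; elim: n => [|n IH].
  have := represents_cst 0.
  by congr represents; apply/funext => x; rewrite big_ord0.
have := represents_lin _ _ _ _ (c n) IH (Ff n).
by congr represents; apply/funext => x; rewrite big_ord_recr/= [c n * _]mulrC.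
Qed.

(** Expectation and [L] are both positive and normalised, hence 1-Lipschitz for the uniform norm: an
    approximation within [e / 2] on each side costs at most [e] in total. *)
Lemma represents_uniform (F : O -> R) (f : T -> R) : measurable_fun setT F ->
  (forall e, 0 < e -> exists G g, [/\ represents G g,
     forall o, `|F o - G o| <= e & forall t, `|f t - g t| <= e]) ->
  represents F f.
Proof.
move=> mF app.
have bnd U (f' g' : U -> R) e : bounded_real g' ->
    (forall t, `|f' t - g' t| <= e) -> bounded_real f'.
  move=> [M gM] fg; exists (e + M) => t.
  by rewrite -(subrK (g' t) (f' t)) (le_trans (ler_normD _ _))// lerD.
have [G1 [g1 [[_ bG1 bg1 _] FG1 fg1]]] := app 1 ltr01.
have bF : bounded_real F by exact: bnd bG1 FG1.
have bf : bounded_real f by exact: bnd bg1 fg1.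
split=> //; apply/eqP; rewrite -subr_eq0 -normr_le0; apply/ler_addgt0Pl => e e0.
rewrite addr0.
have e20 : 0 < e / 2 by rewrite divr_gt0.
have [G [g [rG FG fg]]] := app _ e20.
have [mG bG bg GE] := rG.
have iF := bounded_integrable _ _ _ P _ mF bF.
have iG := bounded_integrable _ _ _ P _ mG bG.
have iD : P.-integrable setT (EFin \o (fun o => F o - G o)).
  by apply: bounded_integrable; [exact: measurable_funB|exists (e / 2)].
have h1 : `|\int[P]_o F o - \int[P]_o G o| <= e / 2.
  rewrite -RintegralB//; rewrite (le_trans (le_normr_Rintegral _ _))//.
  rewrite -[leRHS](Rintegral_probability_cst _ _ _ P); apply: le_Rintegral => //.
    exact: integrable_norm.
  by apply: bounded_integrable => //; exact: bounded_real_cst.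
have h2 : `|L f - L g| <= e / 2.
  have cE (c : R) : L (fun=> c) = c.
    have [_ _ _ <-] := represents_cst c.
    exact: Rintegral_probability_cst.
  have mono (f1 f2 : T -> R) : bounded_real f1 -> bounded_real f2 ->
      (forall t, f1 t <= f2 t + e / 2) -> L f1 - L f2 <= e / 2.
    move=> b1 b2 le12.
    have b2e := bounded_real_lin _ _ _ _ 1 b2 (bounded_real_cst R T (e / 2)).
    have : 0 <= L (fun t => (f2 t + 1 * (e / 2)) + (-1) * f1 t).
      apply: L_ge0; first exact: bounded_real_lin.
      by move=> t; rewrite mul1r mulN1r subr_ge0.
    by rewrite !Llin ?cE//; [lra|exact: bounded_real_cst].
  rewrite ler_norml; apply/andP; split.
    rewrite lerNl opprB; apply: mono => // t.
    by have := fg t; rewrite ler_norml => /andP[]; lra.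
  apply: mono => // t.
  by have := fg t; rewrite ler_norml => /andP[]; lra.
rewrite -(subrK (\int[P]_o G o) (\int[P]_o F o)) GE -addrA.
rewrite (le_trans (ler_normD _ _))// [leRHS]splitr lerD//; first by rewrite -GE.
by rewrite distrC.
Qed.

End transport.

(** The digits of the [u i] are replaced by random bits with the same means of pairwise products.
    Truncated expansions, and products of two of them, are finite combinations of such products, and
    they converge uniformly at rate [2 ^- n] on both sides. *)
Lemma unit_representation (R : realType) (T : Type) (L : (T -> R) -> R)
    (u : nat -> T -> R) :
  L (cst 1) = 1 ->
  (forall f g a, bounded_real f -> bounded_real g ->
    L (fun t => f t + a * g t) = L f + a * L g) ->
  (forall f, bounded_real f -> (forall t, 0 <= f t) -> 0 <= L f) ->
  (forall i t, 0 <= u i t < 1) ->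
  exists (d : measure_display) (U : measurableType d) (P : probability U R)
    (D : nat -> U -> R),
  [/\ forall i o, 0 <= D i o <= 1,
      forall i, represents _ _ L _ _ P (D i) (u i) &
      forall i j, represents _ _ L _ _ P (fun o => D i o * D j o)
        (fun t => u i t * u j t)].
Proof.
move=> L1 Llin L_ge0 u01.
pose b (a : nat * nat) t := bit R (u a.1 t) a.2.
have [d [U [P [B [mB PB]]]]] := bit_measure _ _ _ b L1 Llin L_ge0.
pose S i n o := bit_sum R (fun k => B (i, k) o) n.
pose D i o := bit_lim R (fun k => B (i, k) o).
have repBB a c : represents _ _ L _ _ P (fun o => (B a o)%:R * (B c o)%:R)
    (fun t => (b a t)%:R * (b c t)%:R).
  have BBE : (fun o => (B a o)%:R * (B c o)%:R) =
      \1_([set o | B a o] `&` [set o | B c o]) :> (U -> R).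
    apply/funext => o; rewrite indicI /= !indicE.
    have BE e : (o \in [set o | B e o]) = B e o.
      by apply/idP/idP; rewrite inE.
    by rewrite !BE.
  have mBB : measurable ([set o | B a o] `&` [set o | B c o]).
    exact: measurableI.
  split.
  - by rewrite BBE; exact: measurable_indic.
  - by exists 1 => o; case: (B a o); case: (B c o);
      rewrite ?mulr1 ?mulr0 ?normr0 ?normr1.
  - by exists 1 => o; case: (b a o); case: (b c o);
      rewrite ?mulr1 ?mulr0 ?normr0 ?normr1.
  - by rewrite BBE /Rintegral integral_indic// setIT [X in fine X](PB a c).
(* A digit is its own square. *)
have repB a : represents _ _ L _ _ P (fun o => (B a o)%:R) (fun t => (b a t)%:R).
  by have := repBB a a; congr represents; apply/funext => x;
    case: (_ a x); rewrite ?mulr1 ?mulr0.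
have repS i n : represents _ _ L _ _ P (S i n) (dyadic R ^~ n \o u i).
  have := represents_sum _ _ _ L1 Llin _ _ P n (fun k => 2 ^- k.+1)
    _ _ (fun k => repB (i, k)).
  by congr represents; apply/funext => t /=; rewrite -bit_sum_dyadic.
have repSS i j n : represents _ _ L _ _ P (fun o => S i n o * S j n o)
    (fun t => dyadic R (u i t) n * dyadic R (u j t) n).
  have rep1 k : represents _ _ L _ _ P (fun o => (B (i, k) o)%:R * S j n o)
      (fun t => (b (i, k) t)%:R * dyadic R (u j t) n).
    have := represents_sum _ _ _ L1 Llin _ _ P n (fun k => 2 ^- k.+1)
      _ _ (fun l => repBB (i, k) (j, l)).
    congr represents; apply/funext => t /=.
      by rewrite /S /bit_sum mulr_sumr; apply: eq_bigr => l _; rewrite mulrA.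
    rewrite -bit_sum_dyadic /bit_sum mulr_sumr.
    by apply: eq_bigr => l _; rewrite mulrA.
  have := represents_sum _ _ _ L1 Llin _ _ P n (fun k => 2 ^- k.+1) _ _ rep1.
  congr represents; apply/funext => t /=.
    by rewrite {2}/S /bit_sum mulr_suml; apply: eq_bigr => l _; rewrite mulrAC.
  rewrite -[in RHS](bit_sum_dyadic _ (u i t)) /bit_sum mulr_suml.
  by apply: eq_bigr => l _; rewrite mulrAC.
have SD i n o : S i n o <= D i o <= S i n o + 2 ^- n by exact: bit_sum_lim.
have S0 i n o : 0 <= S i n o.
  by apply: sumr_ge0 => k _; rewrite mulr_ge0.
have D01 i o : 0 <= D i o <= 1.
  have := SD i 0 o; rewrite /S /bit_sum big_ord0 add0r expr0 invr1 => /andP[-> ->].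
  by [].
have d01 i n t : [/\ 0 <= dyadic R (u i t) n, dyadic R (u i t) n <= u i t &
    u i t <= dyadic R (u i t) n + 2 ^- n].
  have /andP[l r] := dyadicP _ _ n (u01 i t).
  split=> //; last exact: ltW.
  rewrite -bit_sum_dyadic; apply: sumr_ge0 => k _; exact: mulr_ge0.
have small (e : R) : 0 < e -> exists n, 2 ^- n <= e.
  move=> e0; have pow0 := half_pow_cvg0 R.
  move/cvgrPdist_le : pow0 => /(_ _ e0) [n _ /(_ n (leqnn _))] /=.
  by rewrite sub0r normrN ger0_norm ?invr_ge0 ?exprn_ge0// => h; exists n.
have mD i : measurable_fun setT (D i).
  apply: (@measurable_fun_cvg _ _ _ _ (S i)) => [n|w _].
    by have [] := repS i n.
  apply/cvgrPdist_le => e e0; have [n ne] := small _ e0.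
  exists n => // m /= nm; have /andP[l r] := SD i m w.
  rewrite ger0_norm ?subr_ge0//.
  have : 2 ^- m <= 2 ^- n :> R.
    by rewrite lef_pV2 ?posrE ?exprn_gt0// ler_weXn2l// ler1n.
  lra.
have prod (x y x' y' e : R) : 0 <= x <= 1 -> 0 <= y <= 1 -> x - e <= x' <= x ->
    y - e <= y' <= y -> 0 <= x' -> 0 <= y' -> `|x * y - x' * y'| <= e + e.
  move=> /andP[x0 x1] /andP[y0 y1] /andP[xl xr] /andP[yl yr] x'0 y'0.
  rewrite ger0_norm; last by rewrite subr_ge0 ler_pM.
  have -> : x * y - x' * y' = (x - x') * y + x' * (y - y') by ring.
  apply: lerD.
    rewrite -[leRHS]mulr1 ler_pM//; lra.
  rewrite -[leRHS]mul1r ler_pM//; lra.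
exists d, U, P, D; split=> // [i|i j].
  apply: represents_uniform => // e e0; have [n ne] := small _ e0.
  exists (S i n), (dyadic R ^~ n \o u i); split=> // [w|t].
    have /andP[l r] := SD i n w.
    by rewrite ger0_norm ?subr_ge0//; lra.
  have [l m r] := d01 i n t.
  by rewrite ger0_norm ?subr_ge0//=; lra.
apply: represents_uniform => //; first exact: measurable_funM.
move=> e e0; have e20 : 0 < e / 2 by rewrite divr_gt0.
have [n ne] := small _ e20.
exists (fun o => S i n o * S j n o),
  (fun t => dyadic R (u i t) n * dyadic R (u j t) n); split=> // [w|t].
  rewrite [leRHS]splitr; apply: prod => //.
    by have /andP[l r] := SD i n w; apply/andP; split; lra.
  by have /andP[l r] := SD j n w; apply/andP; split; lra.
have [l1 m1 r1] := d01 i n t; have [l2 m2 r2] := d01 j n t.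
have /andP[p1 q1] := u01 i t; have /andP[p2 q2] := u01 j t.
by rewrite [leRHS]splitr; apply: prod => //; apply/andP; split=> //; lra.
Qed.

(** * The moment problem for quadratic forms *)

Definition sign_cone (R : realType) (E : set R) : Prop :=
  [\/ E = setT, E = [set t : R | 0 <= t] | E = [set t : R | t <= 0]].

Lemma sign_cone0 (R : realType) (E : set R) : sign_cone R E -> E 0.
Proof. by case=> ->; rewrite /= ?lexx. Qed.

Lemma sign_coneZ (R : realType) (E : set R) a v : sign_cone R E -> 0 <= a ->
  E v -> E (a * v).
Proof.
case=> -> //= a0 v0; first exact: mulr_ge0.
by rewrite mulr_ge0_le0.
Qed.

(** The two ranges differ on purpose: decoding must stay in [E] on the closed interval, since random
    digits may sum to 1, whereas encoding must avoid 1 to have a greedy expansion. *)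
Lemma sign_cone_coding (R : realType) (E : set R) b : sign_cone R E -> 0 <= b ->
  exists al de, (forall t, 0 <= t <= 1 -> E (al * t + de)) /\
    (forall v, E v -> `|v| <= b -> exists2 u, 0 <= u < 1 & v = al * u + de).
Proof.
case=> -> b0 /=.
(* The extra 1 in the scale keeps the code below 1, and the divisor nonzero when [b = 0]. *)
- exists (2 * b + 1), (- b); split=> // v _; rewrite ler_norml => /andP[l r].
  have p : 0 < 2 * b + 1 by lra.
  exists ((v + b) / (2 * b + 1)); last by field; rewrite gt_eqF.
  by rewrite divr_ge0 ?ltr_pdivrMr//=; lra.
- exists (b + 1), 0; split.
    by move=> t /andP[t0 _]; rewrite addr0 mulr_ge0// addr_ge0.
  move=> v v0; rewrite ger0_norm// => vb.
  have p : 0 < b + 1 by lra.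
  exists (v / (b + 1)); last by field; rewrite gt_eqF.
  by rewrite divr_ge0 ?ltr_pdivrMr//=; lra.
- exists (- (b + 1)), 0; split.
    by move=> t /andP[t0 _]; rewrite addr0 mulNr oppr_le0 mulr_ge0// addr_ge0.
  move=> v v0; rewrite ler0_norm// => vb.
  have p : 0 < b + 1 by lra.
  exists (- v / (b + 1)); last by field; rewrite gt_eqF.
  by rewrite divr_ge0 ?ltr_pdivrMr//=; lra.
Qed.

(* The list of terms [(c, i, j)] stands for the form [\sum c * v_i * v_j],
   evaluated at an arbitrary matrix [K] in place of [v_i * v_j]. *)
Definition quad (R : realType) (s : seq (R * nat * nat)) (K : nat -> nat -> R) : R :=
  \sum_(p <- s) p.1.1 * K p.1.2 p.2.

Lemma quad_cat (R : realType) s1 s2 K : quad R (s1 ++ s2) K = quad R s1 K + quad R s2 K.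
Proof. by rewrite /quad big_cat. Qed.

Lemma quad_scale (R : realType) a s K :
  quad R [seq (a * p.1.1, p.1.2, p.2) | p <- s] K = a * quad R s K.
Proof.
by rewrite /quad big_map mulr_sumr; apply: eq_bigr => p _; rewrite mulrA.
Qed.

Section moment_problem.
Variables (R : realType) (E : set R) (K : nat -> nat -> R).
Hypothesis hE : sign_cone R E.
Hypothesis Kpos : forall s : seq (R * nat * nat),
  (forall v : nat -> R, (forall i, E (v i)) -> 0 <= quad R s (fun i j => v i * v j)) ->
  0 <= quad R s K.

Let Kii_ge0 i : 0 <= K i i.
Proof.
have := Kpos [:: (1, i, i)]; rewrite /quad big_seq1 /= mul1r; apply=> v _.
by rewrite /quad big_seq1 /= mul1r -expr2 sqr_ge0.
Qed.

(** With these weights [c i * K i i <= 2 ^- i.+1], so the diagonal of [K] obeys the same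
    normalisation as the squares of a vector of [T]; [1 +] keeps the inverse finite. *)
Let c i : R := (2 ^+ i.+1 * (1 + K i i))^-1.

Let c_gt0 i : 0 < c i.
Proof. by rewrite invr_gt0 mulr_gt0 ?exprn_gt0// ltr_pwDl. Qed.

Let cK_le1 n : \sum_(i < n) c i * K i i <= 1.
Proof.
suff : \sum_(i < n) c i * K i i <= 1 - 2 ^- n.
  by move=> /le_trans; apply; rewrite gerBl invr_ge0 exprn_ge0.
elim: n => [|n IH]; first by rewrite big_ord0 expr0 invr1 subrr.
rewrite big_ord_recr /=; have := half_pow R n.
suff : c n * K n n <= 2 ^- n.+1 by lra.
rewrite /c invfM -mulrA -[leRHS]mulr1 ler_wpM2l//.
rewrite mulrC ler_pdivrMr ?mul1r; last by rewrite ltr_pwDl.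
by rewrite lerDr.
Qed.

Let unit_vec (v : nat -> R) : Prop :=
  (forall i, E (v i)) /\ forall n, \sum_(i < n) c i * v i ^+ 2 <= 1.

Let T := {v : nat -> R | unit_vec v}.

Let vec (t : T) : nat -> R := sval t.

Let b i : R := 1 + (c i)^-1.

Let T_bound (t : T) i : `|vec t i| <= b i.
Proof.
have [_ /(_ i.+1)] := svalP t; rewrite big_ord_recr /= => le1.
have : c i * vec t i ^+ 2 <= 1.
  apply: le_trans le1; rewrite lerDr sumr_ge0// => j _.
  by rewrite mulr_ge0 ?sqr_ge0// ltW.
rewrite mulrC -ler_pdivlMr// mul1r => v2.
(* [|x| <= 1 + x ^+ 2] avoids a square root. *)
rewrite /b; apply: le_trans (lerD (lexx 1) v2).
have := sqr_ge0 (`|vec t i| - 1); rewrite -[vec t i ^+ 2]real_normK ?num_real//.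
by have := normr_ge0 (vec t i); nra.
Qed.

(* The normalisation by [c] turns the cone into a bounded set on which the
   constants are dominated by quadratic forms: on [T] a form bounded below by
   [- al] is, by homogeneity, bounded below by [- al * \sum_i c i * v i ^+ 2]. *)
Let quad_pos s al :
  (forall t : T, 0 <= al + quad R s (fun i j => vec t i * vec t j)) ->
  0 <= al + quad R s K.
Proof.
move=> pos.
have T0 : unit_vec (fun=> 0).
  split=> [i|n]; first exact: sign_cone0.
  by rewrite big1 ?ler01// => i _; rewrite expr0n mulr0.
have al0 : 0 <= al.
  have := pos (exist _ _ T0); rewrite /quad big1 ?addr0// => p _.
  by rewrite /vec /= !mulr0.
pose n := \max_(p <- s) maxn p.1.2.+1 p.2.+1.
have lt_n p : p \in s -> (p.1.2 < n)%N /\ (p.2 < n)%N.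
  move=> ps; have : (maxn p.1.2.+1 p.2.+1 <= n)%N by exact: leq_bigmax_seq.
  by rewrite geq_max => /andP[].
pose s' := [seq (al * c i, i, i) | i <- index_iota 0 n].
have quad_s' K' : quad R s' K' = al * \sum_(i < n) c i * K' i i.
  rewrite /quad big_map /= big_mkord mulr_sumr.
  by apply: eq_bigr => i _; rewrite mulrA.
have : 0 <= quad R (s ++ s') K.
  apply: Kpos => v vE; rewrite quad_cat quad_s'.
  set N := \sum_(i < n) _.
  have term0 i : 0 <= c i * (v i * v i) by rewrite mulr_ge0 -?expr2 ?sqr_ge0// ltW.
  have N0 : 0 <= N by apply: sumr_ge0.
  (* If [N = 0], every coordinate occurring in [s] vanishes. Otherwise [v], cut off at [n] and
     divided by the square root of [N], belongs to [T]. *)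
  have [N00|Nn0] := eqVneq N 0.
    rewrite N00 mulr0 addr0 /quad big_seq big1// => p /lt_n[p1 _].
    have /eqP := N00; rewrite psumr_eq0// => /allP /(_ (Ordinal p1)).
    rewrite mem_index_enum => /(_ isT) /=.
    rewrite mulf_eq0 gt_eqF//= mulf_eq0 orbb => /eqP ->.
    by rewrite mul0r mulr0.
  have Np : 0 < N by rewrite lt_neqAle eq_sym Nn0.
  pose q := (Num.sqrt N)^-1.
  have q2 : q ^+ 2 = N^-1 by rewrite exprVn sqr_sqrtr.
  pose w i := if (i < n)%N then q * v i else 0.
  have wT : unit_vec w.
    split=> [i|m].
      rewrite /w; case: ifP => _; last exact: sign_cone0.
      by apply: sign_coneZ => //; rewrite invr_ge0 sqrtr_ge0.
    have -> : 1 = \sum_(i < n) c i * w i ^+ 2.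
      rewrite -(divff Nn0) mulrC mulr_sumr; apply: eq_bigr => i _.
      by rewrite /w ltn_ord exprMn q2; ring.
    have wge0 i : 0 <= c i * w i ^+ 2 by rewrite mulr_ge0 ?sqr_ge0// ltW.
    have [mn|nm] := leqP m n.
      rewrite (big_ord_widen _ (fun i => c i * w i ^+ 2) mn) big_mkcond /=.
      by apply: ler_sum => i _; case: ifP => // _; exact: wge0.
    rewrite (big_ord_widen _ (fun i => c i * w i ^+ 2) (ltnW nm)).
    rewrite [leRHS]big_mkcond /=; apply: ler_sum => i _; case: ifPn => // ni.
    by rewrite /w (negbTE ni) expr0n mulr0.
  have := pos (exist _ _ wT).
  rewrite (_ : quad _ _ _ = N^-1 * quad R s (fun i j => v i * v j)).
    rewrite -(ler_pM2l Np) mulr0 mulrDr mulrA divff// mul1r addrC.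
    by rewrite (mulrC al).
  rewrite /quad mulr_sumr big_seq [RHS]big_seq; apply: eq_bigr => p /lt_n[p1 p2].
  by rewrite /vec /= /w p1 p2 -q2; ring.
(* By [cK_le1] the added diagonal terms contribute at most [al] at [K]. *)
rewrite quad_cat quad_s' addrC => /le_trans; apply; rewrite lerD2r.
by rewrite -[leRHS]mulr1 ler_wpM2l.
Qed.

Lemma moment_problem : exists (d : measure_display) (U : measurableType d)
  (P : probability U R) (Z : nat -> U -> R),
  [/\ forall i x, E (Z i x), forall i, measurable_fun setT (Z i),
      forall i, bounded_real (Z i) &
      forall i j, \int[P]_x (Z i x * Z j x) = K i j].
Proof.
(* Several pairs [(al, s)] may give the same function on [T]; that they give the same value at [K]
   is a consequence of positivity. *)
pose G0 : set ((T -> R) * R) := [set p | exists al s,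
  p = (fun t => al + quad R s (fun i j => vec t i * vec t j), al + quad R s K)].
have [||L [L1 Llin Lpos LE]] := positive_extension _ _ G0.
- split.
  + exists 1, [::]; rewrite /quad big_nil addr0; congr pair.
    by apply/funext => t; rewrite big_nil addr0.
  + move=> _ _ _ _ a [al [s [-> ->]]] [al' [s' [-> ->]]].
    exists (al + a * al'), (s ++ [seq (a * p.1.1, p.1.2, p.2) | p <- s']).
    congr pair; [apply/funext => t|]; rewrite quad_cat quad_scale; ring.
  + by move=> _ _ [al [s [-> ->]]] pos; exact: quad_pos.
- move=> _ _ [al [s [-> _]]]; exists (`|al| + \sum_(p <- s) `|p.1.1| * (b p.1.2 * b p.2)).
  move=> t; rewrite (le_trans (ler_normD _ _))// lerD2l.
  rewrite (le_trans (ler_norm_sum _ _ _))//; apply: ler_sum => p _.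
  by rewrite !normrM ler_wpM2l// ler_pM.
have b0 i : 0 <= b i by rewrite addr_ge0// invr_ge0 ltW.
have /choice[al] : forall i, exists al, exists de,
    (forall t, 0 <= t <= 1 -> E (al * t + de)) /\
    (forall v, E v -> `|v| <= b i -> exists2 u, 0 <= u < 1 & v = al * u + de).
  by move=> i; exact: sign_cone_coding.
move=> /choice[de codeP].
have /choice[u uP] : forall i, exists u : T -> R, forall t,
    0 <= u t < 1 /\ vec t i = al i * u t + de i.
  move=> i; suff /choice[w wP] : forall t, exists w,
      0 <= w < 1 /\ vec t i = al i * w + de i by exists w.
  move=> t; have [//||w w01 wE] := (codeP i).2 (vec t i); last by exists w.
  - by have [] := svalP t.
  - exact: T_bound.
have [|d [U [P [D [D01 repD repDD]]]]] :=
  unit_representation _ _ L u L1 Llin Lpos.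
  by move=> i t; have [] := uP i t.
have repZ i : represents _ _ L _ _ P (fun x => de i + al i * D i x) (vec ^~ i).
  have := represents_lin _ _ _ Llin _ _ _ _ _ _ _ (al i)
    (represents_cst _ _ _ L1 Llin _ _ P (de i)) (repD i).
  by congr represents; apply/funext => t; rewrite (uP i t).2 addrC.
have repZZ i j : represents _ _ L _ _ P
   (fun x => (de i + al i * D i x) * (de j + al j * D j x))
   (fun t => vec t i * vec t j).
  have r0 := represents_cst _ _ _ L1 Llin _ _ P (de i * de j).
  have r1 := represents_lin _ _ _ Llin _ _ _ _ _ _ _ (al i * de j) r0 (repD i).
  have r2 := represents_lin _ _ _ Llin _ _ _ _ _ _ _ (de i * al j) r1 (repD j).
  have := represents_lin _ _ _ Llin _ _ _ _ _ _ _ (al i * al j) r2 (repDD i j).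
  congr represents; apply/funext => t /=; first ring.
  by rewrite (uP i t).2 (uP j t).2; ring.
exists d, U, P, (fun i x => de i + al i * D i x); split=> [i x|i|i|i j].
- by rewrite addrC; apply: (codeP i).1.
- by have [] := repZ i.
- by have [] := repZ i.
- have [_ _ _ ->] := repZZ i j; apply: LE.
  exists 0, [:: (1, i, j)]; rewrite /quad big_seq1 add0r mul1r; congr pair.
  by apply/funext => t; rewrite big_seq1 add0r mul1r.
Qed.

End moment_problem.

(** * Mean square limits *)

(** By Cauchy-Schwarz the total variation [V] satisfies [V m ^+ 2 <= 2 * M], whence convergence. The
    bound then comes from [y m ^+ 2 <= 2 * y 0 ^+ 2 + 2 * (y m - y 0) ^+ 2]. *)
Lemma fast_cauchy (R : realType) (y : nat -> R) (M : R) :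
  (forall m, \sum_(n < m) 2 ^+ n * (y n.+1 - y n) ^+ 2 <= M) ->
  cvgn y /\ forall m, y m ^+ 2 <= 2 * y 0 ^+ 2 + 4 * M.
Proof.
move=> SM.
pose D n := `|y n.+1 - y n|.
pose S m := \sum_(n < m) 2 ^+ n * (y n.+1 - y n) ^+ 2.
pose V m := \sum_(n < m) D n.
have D2 n : (y n.+1 - y n) ^+ 2 = D n ^+ 2 by rewrite real_normK ?num_real.
have p_gt0 n : 0 < 2 ^- n :> R by rewrite invr_gt0 exprn_gt0.
have S_ge0 m : 0 <= S m.
  by apply: sumr_ge0 => n _; rewrite mulr_ge0 ?sqr_ge0.
have V_ge0 m : 0 <= V m by apply: sumr_ge0 => n _; exact: normr_ge0.
(* Cauchy-Schwarz with the weights [2 ^- n], whose sum is [2 - 2 ^- m * 2]. *)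
have CS m : V m ^+ 2 <= (2 - 2 * 2 ^- m) * S m.
  elim: m => [|m IH]; first by rewrite /V big_ord0 expr0n /= expr0; lra.
  rewrite /V big_ord_recr /= -/(V m) /S big_ord_recr /= -/(S m) D2.
  have hp := half_pow R m.
  have pq : 2 ^+ m * 2 ^- m = 1 :> R by rewrite divff// expf_neq0.
  have pm_gt0 : 0 < 2 ^+ m :> R by rewrite exprn_gt0.
  have h := p_gt0 m.
  set p := 2 ^+ m in pq pm_gt0 *; set q := 2 ^- m in hp pq h IH *.
  set q' := 2 ^- m.+1 in hp *.
  have -> : 2 - 2 * q' = (2 - 2 * q) + q by lra.
  have q1 : q <= 1 by rewrite /q invf_le1// exprn_ege1// ler1n.
  set w := 2 - 2 * q in IH *.
  have w0 : 0 <= w by rewrite /w; lra.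
  have Vm := V_ge0 m; have Sm := S_ge0 m; have Dm : 0 <= D m by exact: normr_ge0.
  (* Arithmetic-geometric mean: by induction and [p * q = 1], the square of the left side is at most
     four times the product of the two terms on the right. *)
  have key : 2 * V m * D m <= w * (p * D m ^+ 2) + q * S m.
    have x0 : 0 <= w * (p * D m ^+ 2) by rewrite !mulr_ge0 ?sqr_ge0// ltW.
    have z0 : 0 <= q * S m by rewrite mulr_ge0// ltW.
    rewrite -(@ler_pXn2r _ 2)// ?nnegrE; [|by rewrite !mulr_ge0|exact: addr_ge0].
    have e1 : (2 * V m * D m) ^+ 2 = 4 * V m ^+ 2 * D m ^+ 2 by ring.
    have e2 : 4 * V m ^+ 2 * D m ^+ 2 <= 4 * (w * S m) * D m ^+ 2.
      by rewrite ler_wpM2r ?sqr_ge0// ler_pM2l.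
    have e3 : 4 * (w * S m) * D m ^+ 2 = 4 * (w * (p * D m ^+ 2)) * (q * S m).
      by rewrite -[LHS]mulr1 -pq; ring.
    rewrite e1 (le_trans e2)// e3.
    have := sqr_ge0 (w * (p * D m ^+ 2) - q * S m); nra.
  have -> : (V m + D m) ^+ 2 = V m ^+ 2 + 2 * V m * D m + D m ^+ 2 by ring.
  have -> : (w + q) * (S m + p * D m ^+ 2) =
      w * S m + (w * (p * D m ^+ 2) + q * S m) + (p * q) * D m ^+ 2 by ring.
  by rewrite pq mul1r lerD2r lerD.
have M0 : 0 <= M by have := SM 0; rewrite big_ord0.
have V2 m : V m ^+ 2 <= 2 * M.
  apply: le_trans (CS m) _; have := SM m; rewrite -/(S m).
  by have := p_gt0 m; have := S_ge0 m; nra.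
have yE m : y m = y 0 + \sum_(n < m) (y n.+1 - y n).
  elim: m => [|m IH]; first by rewrite big_ord0 addr0.
  by rewrite big_ord_recr /= addrA -IH; ring.
have yV m : `|y m - y 0| <= V m.
  by rewrite yE addrC addKr; exact: ler_norm_sum.
split.
  have cs : cvgn (series (fun n => y n.+1 - y n)).
    apply: normed_cvg; apply: nondecreasing_is_cvgn.
      apply/nondecreasing_seqP => n.
      by rewrite /normed_series_of /series /= !big_mkord big_ord_recr/= lerDl.
    exists (1 + 2 * M) => _ [m _ <-]; rewrite /normed_series_of /series /= big_mkord -/(V m).
    by have := V2 m; have := sqr_ge0 (V m - 1); nra.
  have -> : y = fun m => y 0 + series (fun n => y n.+1 - y n) m.
    by apply/funext => m; rewrite [LHS]yE /series /= big_mkord.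
  by apply: is_cvgD => //; exact: is_cvg_cst.
move=> m; have := yV m; have := V2 m; have := V_ge0 m.
set v := V m => v0 v2; rewrite ler_norml => /andP[l r].
have : (y m - y 0) ^+ 2 <= v ^+ 2.
  have : 0 <= (v - (y m - y 0)) * (v + (y m - y 0)) by apply: mulr_ge0; lra.
  by nra.
have := sqr_ge0 (y m - 2 * y 0); nra.
Qed.

(** [G] is the majorant for dominated convergence. The alternative valid at every [w] serves to keep
    the limit in the cone everywhere and not only almost everywhere. *)
Lemma fast_l2 (R : realType) d (U : measurableType d) (P : probability U R)
    (Y : nat -> U -> R) :
  (forall n, measurable_fun setT (Y n)) -> (forall n, bounded_real (Y n)) ->
  (forall n, \int[P]_w (Y n.+1 w - Y n w) ^+ 2 <= 4 ^- n) ->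
  exists (Z : U -> R) (G : U -> \bar R),
  [/\ measurable_fun setT Z, P.-integrable setT G,
      forall w, Z w = 0 \/ Y ^~ w @ \oo --> Z w,
      {ae P, forall w, Y ^~ w @ \oo --> Z w} &
      {ae P, forall w n, ((Y n w ^+ 2)%:E <= G w)%E}].
Proof.
move=> mY bY incr.
(* The weights leave the series integrable, yet it dominates all [Y n ^+ 2]. *)
pose h n w : \bar R := (2 ^+ n * (Y n.+1 w - Y n w) ^+ 2)%:E.
have mh n : measurable_fun setT (h n).
  apply/measurable_EFinP; apply: measurable_funM; first exact: measurable_cst.
  by apply: measurable_funX; exact: measurable_funB.
have h0 n w : (0 <= h n w)%E.
  by rewrite lee_fin mulr_ge0 ?sqr_ge0// exprn_ge0.
pose H w : \bar R := (\sum_(n <oo) h n w)%E.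
have mH : measurable_fun setT H by exact: ge0_emeasurable_sum.
have H0 w : (0 <= H w)%E by apply: nneseries_ge0.
have iH : P.-integrable setT H.
  apply/integrableP; split=> //.
  under eq_integral do rewrite gee0_abs//.
  rewrite integral_nneseries//.
  have bD n : bounded_real (fun w => (Y n.+1 w - Y n w) ^+ 2).
    have [M YM] := bY n.+1; have [N YN] := bY n.
    exists ((M + N) ^+ 2) => w; rewrite normrX.
    rewrite ler_pXn2r// ?nnegrE//; last first.
      by rewrite addr_ge0// (le_trans _ (YM w), le_trans _ (YN w)).
    by rewrite (le_trans (ler_normB _ _))// lerD.
  have mD n : measurable_fun setT (fun w => (Y n.+1 w - Y n w) ^+ 2).
    by apply: measurable_funX; exact: measurable_funB.
  have le_term n : (\int[P]_w h n w <= (2 ^- n)%:E)%E.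
    rewrite /h; under eq_integral do rewrite EFinM.
    have iD := bounded_integrable _ _ _ P _ (mD n) (bD n).
    rewrite integralZl//.
    rewrite -(@fineK _ (\int[P]_w _)%E) ?integrable_fin_num// -EFinM lee_fin.
    have := incr n; rewrite /Rintegral => le4.
    apply: le_trans (ler_wpM2l _ le4) _; first exact: exprn_ge0.
    by rewrite -!exprVn -exprMn (_ : 2 * 4^-1 = 2^-1 :> R)//; lra.
  apply: (@le_lt_trans _ _ 2%:E); last exact: ltry.
  apply: lime_le; first by apply: is_cvg_nneseries => n _ _; exact: integral_ge0.
  apply: nearW => N; rewrite big_mkord.
  apply: (@le_trans _ _ (\sum_(n < N) (2 ^- n)%:E)%E).
    by apply: lee_sum => n _.
  rewrite sumEFin lee_fin.
  suff : \sum_(n < N) 2 ^- n <= 2 - 2 * 2 ^- N :> R.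
    by have : 0 <= 2 ^- N :> R by []; lra.
  elim: N => [|N IH]; first by rewrite big_ord0 expr0; lra.
  by rewrite big_ord_recr/=; have := half_pow R N; lra.
pose A := [set w | H w < +oo]%E.
have mA : measurable A.
  by have := emeasurable_fun_infty_o measurableT mH +oo; rewrite setTI.
have aeA : {ae P, forall w, A w}.
  have := integrable_ae measurableT iH; apply: filterS => w /(_ I) Hw.
  by rewrite /A /= ltey_eq Hw.
have AP w : A w -> cvgn (Y ^~ w) /\
    forall m, Y m w ^+ 2 <= 2 * Y 0 w ^+ 2 + 4 * fine (H w).
  move=> Aw; apply: fast_cauchy => m.
  have Hf : H w \is a fin_num by rewrite ge0_fin_numE.
  rewrite -lee_fin fineK// -sumEFin -(big_mkord xpredT (h ^~ w)).
  exact: nneseries_lim_ge.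
(* The indicator makes the sequence converge everywhere, to 0 off [A]. *)
pose Z w := limn (fun n => Y n w * \1_A w).
have cvZ w : (fun n => Y n w * \1_A w) @ \oo --> Z w.
  rewrite /Z indicE; have [|nAw] := boolP (w \in A).
    rewrite inE => /AP[cv _]; under [X in X @ _ --> _]eq_fun do rewrite mulr1.
    by under [X in lim (X @ _)]eq_fun do rewrite mulr1.
  under [X in X @ _ --> _]eq_fun do rewrite mulr0.
  under [X in lim (X @ _)]eq_fun do rewrite mulr0.
  by rewrite lim_cst//; exact: cvg_cst.
have ZA w : A w -> Y ^~ w @ \oo --> Z w.
  move=> Aw; have := cvZ w; rewrite indicE mem_set//.
  by under [X in X @ _ --> _]eq_fun do rewrite mulr1.
have ZnA w : ~ A w -> Z w = 0.
  move=> nAw; rewrite /Z indicE memNset//.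
  under [X in lim (X @ _)]eq_fun do rewrite mulr0.
  by rewrite lim_cst.
exists Z, (fun w => (2 * Y 0 w ^+ 2)%:E + 4%:E * H w)%E; split.
- apply: (@measurable_fun_cvg _ _ _ _ (fun n w => Y n w * \1_A w)) => [n|w _].
    by apply: measurable_funM => //; exact: measurable_indic.
  exact: cvZ.
- apply: integrableD => //; last exact: integrableZl.
  apply: bounded_integrable.
    by apply: measurable_funM; [exact: measurable_cst|exact: measurable_funX].
  have [M YM] := bY 0; exists (2 * M ^+ 2) => w.
  rewrite normrM normrX ger0_norm// ler_pM2l// ler_pXn2r// nnegrE//.
  exact: le_trans (YM w).
- by move=> w; have [Aw|nAw] := pselect (A w); [right; exact: ZA|left; exact: ZnA].
- by apply: filterS aeA => w; exact: ZA.
- apply: filterS aeA => w Aw n; have [_ /(_ n)] := AP w Aw.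
  have Hf : H w \is a fin_num by rewrite ge0_fin_numE.
  by rewrite -[in X in _ -> X](fineK Hf) -EFinM -EFinD lee_fin.
Qed.

Lemma sign_cone_cvg (R : realType) (E : set R) (y : nat -> R) l :
  sign_cone R E -> (forall n, E (y n)) -> y @ \oo --> l -> E l.
Proof.
case=> -> //= Ey yl.
  by rewrite -(cvg_lim _ yl)//; apply: limr_ge; [exact: cvgP yl|exact: nearW].
by rewrite -(cvg_lim _ yl)//; apply: limr_le; [exact: cvgP yl|exact: nearW].
Qed.

Lemma integrable_sqr_Lfun2 (R : realType) d (U : measurableType d)
    (mu : {measure set U -> \bar R}) (f : U -> R) :
  measurable_fun setT f -> mu.-integrable setT (EFin \o (fun x => f x ^+ 2)) ->
  f \in Lfun mu 2%:E.
Proof.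
move=> mf /integrableP[_ fi]; rewrite inE; apply/andP; split.
  by rewrite inE.
rewrite inE /finite_norm unlock /Lnorm; apply: poweR_lty.
apply: le_lt_trans fi; rewrite le_eqVlt; apply/orP; left; apply/eqP.
by apply: eq_integral => x _ /=; rewrite normrX powR_mulrn.
Qed.

(** Continuity of [rho] at [(x, x)] lets one pick dense points tending to [x] along which [Z] has
    squared increments of mean at most [4 ^- n]. Products of two such sequences converge under a
    common majorant, and their means tend to [rho (x, y)] by continuity. *)
Lemma field_of_dense (R : realType) (X : pmetricType R) (E : set R)
    (rho : X * X -> R) (q : nat -> X)
    d (U : measurableType d) (P : probability U R) (Z : nat -> U -> R) :
  sign_cone R E -> continuous rho ->
  (forall (x : X) (A : set X), nbhs x A -> exists n, A (q n)) ->
  (forall i w, E (Z i w)) -> (forall i, measurable_fun setT (Z i)) ->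
  (forall i, bounded_real (Z i)) ->
  (forall i j, \int[P]_w (Z i w * Z j w) = rho (q i, q j)) ->
  is_noncentered_covariance E rho.
Proof.
move=> hE crho dq ZE mZ bZ ZZ.
have bM := @bounded_real_mul R U.
have iZZ i j : P.-integrable setT (EFin \o (fun w => Z i w * Z j w)).
  by apply: bounded_integrable; [exact: measurable_funM|exact: bM].
have sqE i j : \int[P]_w (Z j w - Z i w) ^+ 2 =
    rho (q j, q j) - rho (q i, q j) - rho (q i, q j) + rho (q i, q i).
  have mZZ i' j' : measurable_fun setT (fun w => Z i' w * Z j' w).
    exact: measurable_funM.
  transitivity (\int[P]_w (Z j w * Z j w + (-2) * (Z i w * Z j w) +
    Z i w * Z i w)); first by apply: eq_Rintegral => w _; ring.
  have i2 : P.-integrable setT (EFin \o (fun w => (-2) * (Z i w * Z j w))).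
    apply: bounded_integrable.
      by apply: measurable_funM => //; exact: measurable_cst.
    by apply: (bM _ _); [exact: bounded_real_cst|exact: bM].
  rewrite RintegralD//; last first.
    apply: bounded_integrable.
      by apply: measurable_funD => //; apply: measurable_funM => //; exact: measurable_cst.
    by apply: bounded_real_lin; exact: bM.
  by rewrite RintegralD// RintegralZl// !ZZ; ring.
have fast (x : X) : exists k : nat -> nat, (fun n => q (k n)) @ \oo --> x /\
    forall n, \int[P]_w (Z (k n.+1) w - Z (k n) w) ^+ 2 <= 4 ^- n.
  (* Four values of [rho] enter the mean squared increment [sqE], with signs that cancel
     [rho (x, x)]; hence the quarter of [4 ^- n]. *)
  have /choice[C CP] : forall n, exists C : set X, nbhs x C /\
      forall u v, C u -> C v -> `|rho (x, x) - rho (u, v)| <= 4 ^- n / 4.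
    move=> n; have e0 : 0 < 4 ^- n / 4 :> R by rewrite divr_gt0// invr_gt0 exprn_gt0.
    have /cvgrPdist_le/(_ _ e0)[[A B] /= [nA nB] AB] := crho (x, x).
    exists (A `&` B); split; first exact: filterI.
    by move=> u v [Au _] [_ Bv]; exact: (AB (u, v)).
  (* Staying in all earlier [C m] puts the points of rank [n] and [n.+1] in the same [C n]. *)
  have nW n : nbhs x (ball x n.+1%:R^-1 `&` [set u | forall m, (m <= n)%N -> C m u]).
    apply: filterI; first by apply: nbhsx_ballx; rewrite invr_gt0.
    elim: n => [|n IH].
      by apply: filterS (CP 0).1 => u C0u m; rewrite leqn0 => /eqP ->.
    apply: filterS2 IH (CP n.+1).1 => u Cu Cn1 m; rewrite leq_eqVlt.
    by move=> /predU1P[-> //|]; exact: Cu.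
  have /choice[k kP] : forall n, exists i,
      ball x n.+1%:R^-1 (q i) /\ forall m, (m <= n)%N -> C m (q i).
    by move=> n; have [i [? ?]] := dq _ _ (nW n); exists i.
  exists k; split.
    apply/cvg_ballP => e e0; near=> n.
    apply: le_ball (kP n).1; rewrite ltW//; near: n.
    by have := near_infty_natSinv_lt (PosNum e0).
  move=> n; rewrite sqE.
  have C1 := (kP n).2 n (leqnn n); have C2 := (kP n.+1).2 n (leqnSn n).
  have := (CP n).2 _ _ C1 C1; have := (CP n).2 _ _ C1 C2; have := (CP n).2 _ _ C2 C2.
  by rewrite !ler_norml => /andP[? ?] /andP[? ?] /andP[? ?]; lra.
have /choice[k kP] := fast.
have limx (x : X) : exists (Zx : U -> R) (G : U -> \bar R),
  [/\ measurable_fun setT Zx, P.-integrable setT G,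
      forall w, Zx w = 0 \/ (fun n => Z (k x n) w) @ \oo --> Zx w,
      {ae P, forall w, (fun n => Z (k x n) w) @ \oo --> Zx w} &
      {ae P, forall w n, ((Z (k x n) w ^+ 2)%:E <= G w)%E}].
  apply: (fast_l2 _ _ _ P (fun n => Z (k x n))) => // n.
  exact: (kP x).2.
have /choice[Zl] := limx => /choice[G ZlP].
have mZl x : measurable_fun setT (Zl x) by have [] := ZlP x.
have ZlE x w : E (Zl x w).
  have [_ _ /(_ w)[->|cv] _ _] := ZlP x; first exact: sign_cone0.
  by apply: sign_cone_cvg hE _ cv => n; exact: ZE.
have cov (x y : X) : P.-integrable setT (EFin \o (fun w => Zl x w * Zl y w)) /\
    (\int[P]_w (Zl x w * Zl y w)%:E)%E = (rho (x, y))%:E.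
  have [_ iGx _ cx gx] := ZlP x; have [_ iGy _ cy gy] := ZlP y.
  have [] := @dominated_convergence _ _ _ P setT measurableT
    (fun n w => (Z (k x n) w * Z (k y n) w)%:E)
    (EFin \o (fun w => Zl x w * Zl y w)) (fun w => G x w + G y w)%E.
  - by move=> n; apply/measurable_EFinP; exact: measurable_funM.
  - by apply/measurable_EFinP; exact: measurable_funM.
  - near=> w => _; apply: cvg_EFin; first exact: nearW.
    apply: cvgM; [near: w; exact: cx|near: w; exact: cy].
  - exact: integrableD.
  - near=> w => n _.
    have gxn : ((Z (k x n) w ^+ 2)%:E <= G x w)%E.
      by move: n; near: w; exact: gx.
    have gyn : ((Z (k y n) w ^+ 2)%:E <= G y w)%E.
      by move: n gxn; near: w; apply: filterS gy => w h n _; exact: h.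
    apply: le_trans (leeD gxn gyn); rewrite -EFinD lee_fin normrM.
    set a := Z _ w; set b := Z _ w.
    rewrite -(real_normK (num_real a)) -(real_normK (num_real b)).
    by have := sqr_ge0 (`|a| - `|b|); have := sqr_ge0 (`|a| + `|b|); nra.
  move=> iZ _ cv; split=> //.
  apply: cvg_unique cv _ => //.
  rewrite (_ : (fun n => _) = EFin \o (fun n => rho (q (k x n), q (k y n)))).
    apply: cvg_EFin; first exact: nearW.
    apply: continuous_cvg; first exact: crho.
    by apply: cvg_pair; [exact: (kP x).1|exact: (kP y).1].
  apply/funext => n /=; rewrite -ZZ /Rintegral fineK//.
  exact: (integrable_fin_num measurableT (iZZ _ _)).
exists d, U, P, (fun x => mfun_Sub (mem_set (mZl x))); split.
  by move=> x w; exact: ZlE.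
split=> [x|x y].
  apply: integrable_sqr_Lfun2; first exact: mZl.
  by have [] := cov x x.
by rewrite unlock /=; exact: (cov x y).2.
Unshelve. all: by end_near. Qed.

(** * Separability *)

Lemma continuous_borel_measurable (R : realType) (X : pmetricType R) (f : X -> R) :
  continuous f -> measurable_fun setT (f : borel X -> R).
Proof.
move=> /continuousP cf; apply: (measurability _ (RGenOpens.measurableE R)).
move=> _ [_ [a [b ->] <-]]; rewrite setTI; apply: sub_sigma_algebra.
by apply: cf; exact: interval_open.
Qed.

Lemma mdist_continuous (R : realType) (X : pmetricType R) (x : X) :
  continuous (mdist x : X -> R).
Proof.
move=> y; apply/cvgrPdist_lt => e e0.
near=> z; have : ball y e z by near: z; exact: nbhsx_ballx.
rewrite ballEmdist /= => yz; rewrite ltr_norml.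
have := metric_triangle x y z; have := metric_triangle x z y.
by rewrite [mdist z y]metric_sym => h1 h2; apply/andP; split; lra.
Unshelve. all: by end_near. Qed.

Lemma ball_measurable (R : realType) (X : pmetricType R) (x : X) e :
  measurable (ball x e : set (borel X)).
Proof.
rewrite ballEmdist.
have := continuous_borel_measurable _ _ _ (mdist_continuous _ _ x).
move=> /(_ measurableT `]-oo, e[%classic); rewrite setTI.
rewrite (_ : _ @^-1` _ = [set y | mdist x y < e]); first by apply; exact: measurable_itv.
by apply/seteqP; split => y /=; rewrite in_itv.
Qed.

Section separability.
Variables (R : realType) (X : pmetricType R)
  (w : {finite_measure set (borel X) -> \bar R}).
Hypothesis hw : positive_measure w.

Lemma ball_measure_gt0 (x : X) e : 0 < e -> (0 < w (ball x e))%E.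
Proof.
move=> e0; apply: (lt_le_trans (hw (ball x e)° (open_interior _) _)).
  by exists x; rewrite /interior; exact: nbhsx_ballx.
apply: le_measure; rewrite ?inE//; last exact: interior_subset.
  by apply: sub_sigma_algebra; exact: open_interior.
exact: ball_measurable.
Qed.

Fixpoint cover_balls (e : R) (s : seq X) : set X :=
  if s is x :: s' then ball x e `|` cover_balls e s' else set0.

Fixpoint packing (e d : R) (s : seq X) : Prop :=
  if s is x :: s' then
    [/\ (d%:E <= w (ball x e))%E, ball x e `&` cover_balls e s' = set0 & packing e d s']
  else True.

Lemma packing_size (e d : R) s : packing e d s ->
  measurable (cover_balls e s : set (borel X)) /\
  (((size s)%:R * d)%:E <= w (cover_balls e s))%E.
Proof.
elim: s => [_|x s IH] /=; first by rewrite mul0r measure0.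
move=> [dx xs /IH[ms ws]]; have mx := ball_measurable _ _ x e.
split; first exact: measurableU.
by rewrite measureU// -natr1 mulrDl mul1r addrC EFinD leeD.
Qed.

(** Disjoint balls of mass at least [d] number at most the total mass divided by [d], which is
    finite. *)
Lemma maximal_packing (e d : R) : 0 < d -> exists s, packing e d s /\
  forall x, ~ packing e d (x :: s).
Proof.
move=> d0; pose Q n := `[< exists2 s, packing e d s & size s = n >].
have Q0 : exists n, Q n by exists 0%N; apply/asboolP; exists [::].
have wfin : w setT \is a fin_num by exact: fin_num_measure.
have Qb n : Q n -> (n <= Num.truncn (fine (w setT) / d))%N.
  move=> /asboolP[s ps <-]; have [ms ws] := packing_size _ _ _ ps.
  rewrite truncn_ge_nat; last by rewrite divr_ge0 ?fine_ge0// ltW.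
  rewrite ler_pdivlMr// -lee_fin fineK//; apply: le_trans ws _.
  by apply: le_measure; rewrite ?inE.
case: (ex_maxnP Q0 Qb) => n /asboolP[s ps sn] maxn.
exists s; split=> // x pxs; have : Q n.+1.
  by apply/asboolP; exists (x :: s) => //=; rewrite sn.
by move=> /maxn; rewrite ltnn.
Qed.

Lemma cover_balls_center (e : R) s (z : X) : cover_balls e s z ->
  exists i, ball (nth point s i) e z.
Proof.
elim: s => //= x s IH [xz|/IH[i iz]]; first by exists 0%N.
by exists i.+1.
Qed.

(** The ball of radius [e] at any [x] has mass at least [d] for some [d] of the form [k.+1%:R^-1];
    by maximality it meets a ball of the packing for [(e, d)], so [x] is within [2 * e] of a centre.
    Countably many finite packings suffice. *)
Lemma dense_sequence : exists q : nat -> X,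
  forall (x : X) (A : set X), nbhs x A -> exists n, A (q n).
Proof.
have /choice[s sP] : forall p : nat * nat, exists s,
    packing p.1.+1%:R^-1 p.2.+1%:R^-1 s /\
    forall x, ~ packing p.1.+1%:R^-1 p.2.+1%:R^-1 (x :: s).
  by move=> p; apply: maximal_packing; rewrite invr_gt0.
(* A code stands for a scale, a mass level and a position in the packing; [point] fills the codes
   and positions that stand for nothing. *)
pose q n : X := if @unpickle (nat * nat * nat)%type n is Some t
  then nth point (s t.1) t.2 else point.
exists q => x A /nbhs_ballP[r /= r0 rA].
have [n nr] : exists n, n.+1%:R^-1 < r / 2.
  have r20 : 0 < r / 2 by rewrite divr_gt0.
  have [n _ /(_ n (leqnn n))] := near_infty_natSinv_lt (PosNum r20).
  by exists n.
set e := n.+1%:R^-1 in nr; have e0 : 0 < e by rewrite invr_gt0.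
have [k kw] : exists k, (k.+1%:R^-1%:E <= w (ball x e))%E.
  have wx0 : (0 < w (ball x e))%E by exact: ball_measure_gt0.
  have wfin : w (ball x e) \is a fin_num.
    by apply: fin_num_measure; exact: ball_measurable.
  have f0 : 0 < fine (w (ball x e)) by rewrite fine_gt0// wx0 ltey_eq wfin.
  have [k _ /(_ k (leqnn k))] := near_infty_natSinv_lt (PosNum f0).
  by move=> /= kw; exists k; rewrite -(fineK wfin) lee_fin ltW.
have [ps maxs] := sP (n, k).
have : ball x e `&` cover_balls e (s (n, k)) !=set0.
  apply/set0P/eqP => disj; apply: (maxs x); split=> //.
move=> [z [xz /cover_balls_center[i iz]]].
exists (pickle (n, k, i)); apply: rA; rewrite /q pickleK /=.
apply: (@le_ball _ _ _ (e + e)); first lra.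
by apply: (ball_triangle xz); exact: ball_sym.
Qed.

End separability.

(** * Nearest points of a dense sequence *)

Section nearest.
Variables (R : realType) (X : pmetricType R) (q : nat -> X).
Hypothesis dq : forall (x : X) (A : set X), nbhs x A -> exists n, A (q n).

Fixpoint near_dist (m : nat) (x : X) : R :=
  if m is m'.+1 then Num.min (mdist (q m'.+1) x) (near_dist m' x)
  else mdist (q 0) x.

(** The strict comparison keeps the smaller index in case of a tie, so the index is a well-defined
    function with finitely many measurable level sets. *)
Fixpoint near_idx (m : nat) (x : X) : nat :=
  if m is m'.+1 then
    if mdist (q m'.+1) x < near_dist m' x then m'.+1 else near_idx m' x
  else 0.

Lemma near_idx_le m x : (near_idx m x < m.+1)%N.
Proof. by elim: m => //= m IH; case: ifP => // _; exact: leqW. Qed.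

Lemma near_idxE m x : mdist (q (near_idx m x)) x = near_dist m x.
Proof. by elim: m => //= m IH; rewrite minElt; case: ifP. Qed.

Lemma near_dist_le m x j : (j <= m)%N -> near_dist m x <= mdist (q j) x.
Proof.
elim: m => [|m IH]; first by rewrite leqn0 => /eqP ->.
rewrite leq_eqVlt => /predU1P[->|jm] /=; rewrite ge_min ?lexx//.
by rewrite IH ?orbT.
Qed.

Lemma near_idx_cvg x : (fun m => q (near_idx m x)) @ \oo --> x.
Proof.
apply/cvg_ballP => e e0; have [j jx] := dq x _ (nbhsx_ballx x e e0).
exists j => // m /= jm; rewrite ballEmdist /= metric_sym near_idxE.
apply: le_lt_trans (near_dist_le _ _ _ jm) _.
by move: jx; rewrite ballEmdist /= metric_sym.
Qed.

Lemma measurable_near_dist m : measurable_fun setT (near_dist m : borel X -> R).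
Proof.
elim: m => [|m IH] /=.
  by apply: continuous_borel_measurable; exact: mdist_continuous.
apply: measurable_minr => //.
by apply: continuous_borel_measurable; exact: mdist_continuous.
Qed.

Lemma measurable_near_idx m : measurable_fun setT (near_idx m : borel X -> nat).
Proof.
elim: m => [|m IH] /=; first exact: measurable_cst.
apply: measurable_fun_ifT => //.
apply: measurable_fun_ltr; last exact: measurable_near_dist.
by apply: continuous_borel_measurable; exact: mdist_continuous.
Qed.

Definition near_cell m (i : nat) : set X := [set x | near_idx m x = i].

Lemma measurable_near_cell m i : measurable (near_cell m i : set (borel X)).
Proof.
have := measurable_near_idx m measurableT [set i].
by rewrite setTI; apply.
Qed.

Lemma near_cell_sum m (f : nat -> R) (x : X) :
  \sum_(i < m.+1) f i * \1_(near_cell m i) x = f (near_idx m x).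
Proof.
rewrite (bigD1 (Ordinal (near_idx_le m x))) //= big1 ?addr0.
  by rewrite indicE mem_set// mulr1.
move=> i; rewrite -val_eqE /= => ni; rewrite indicE memNset ?mulr0//.
by rewrite /near_cell /= => /esym /eqP; rewrite (negbTE ni).
Qed.

Lemma measurable_near_kernel m (f : nat -> nat -> R) :
  measurable_fun setT (fun p : borel X * borel X =>
    f (near_idx m p.1) (near_idx m p.2)).
Proof.
rewrite (_ : (fun p => _) = (fun p : borel X * borel X =>
   \sum_(i < m.+1) (\sum_(j < m.+1) f i j * \1_(near_cell m j) p.2)
     * \1_(near_cell m i) p.1)); last first.
  apply/funext => p; rewrite (near_cell_sum m (fun i =>
    \sum_(j < m.+1) f i j * \1_(near_cell m j) p.2)).
  by rewrite near_cell_sum.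
have m1 i : measurable_fun setT (fun p : borel X * borel X => \1_(near_cell m i) p.1 : R).
  apply: (measurableT_comp (f := \1_(near_cell m i) : borel X -> R)) => //.
  by apply: measurable_indic; exact: measurable_near_cell.
have m2 i : measurable_fun setT (fun p : borel X * borel X => \1_(near_cell m i) p.2 : R).
  apply: (measurableT_comp (f := \1_(near_cell m i) : borel X -> R)) => //.
  by apply: measurable_indic; exact: measurable_near_cell.
apply: measurable_sum => i; apply: measurable_funM => //.
by apply: measurable_sum => j; apply: measurable_funM => //; exact: measurable_cst.
Qed.

(** The product of the Borel sigma-algebras of a general metric space need not contain the open sets
    of the product. Density of [q] makes [f] a pointwise limit of finite combinations of indicators
    of rectangles. *)
Lemma continuous_kernel_measurable (f : X * X -> R) : continuous f ->
  measurable_fun setT (f : borel X * borel X -> R).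
Proof.
move=> cf; pose h m (p : borel X * borel X) : R :=
  f (q (near_idx m p.1), q (near_idx m p.2)).
apply: (@measurable_fun_cvg _ (borel X * borel X)%type R setT h) => [m|[x y] _ /=].
  exact: (measurable_near_kernel m (fun i j => f (q i, q j))).
apply: continuous_cvg; first exact: cf.
by apply: cvg_pair; exact: near_idx_cvg.
Qed.

End nearest.

(** * Products *)

Section product_integral.
Variables (R : realType) (d : measure_display) (T : measurableType d)
  (w : {finite_measure set T -> \bar R}).

Lemma product_measure_fin : ((w \x w) setT < +oo)%E.
Proof.
have wT : w setT \is a fin_num by exact: fin_num_measure.
by rewrite -setXTT [X in (X < _)%E]product_measure1E// lte_mul_pinfty// ltey_eq wT.
Qed.

Lemma integrable_tensor (f g : T -> R) :
  w.-integrable setT (EFin \o f) -> w.-integrable setT (EFin \o g) ->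
  (w \x w)%E.-integrable setT (EFin \o (fun p => f p.1 * g p.2)).
Proof.
move=> fi gi.
have mf : measurable_fun setT f by apply/measurable_EFinP; exact: measurable_int fi.
have mg : measurable_fun setT g by apply/measurable_EFinP; exact: measurable_int gi.
have mfg : measurable_fun setT (fun p : T * T => f p.1 * g p.2).
  by apply: measurable_funM; [exact: (measurableT_comp mf)|exact: (measurableT_comp mg)].
apply/integrable12ltyP; first exact/measurable_EFinP.
have /integrableP[_ fo] := fi; have /integrableP[_ go] := gi.
under eq_integral => x _.
  under eq_integral do rewrite /= normrM EFinM.
  rewrite ge0_integralZl//; last by do 2 apply: measurableT_comp => //.
  over.
rewrite ge0_integralZr//; last by apply: integral_ge0.
  by rewrite lte_mul_pinfty// ?integral_ge0// ge0_fin_numE// integral_ge0.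
by do 2 apply: measurableT_comp => //.
Qed.

Lemma Rintegral_tensor (f g : T -> R) :
  w.-integrable setT (EFin \o f) -> w.-integrable setT (EFin \o g) ->
  \int[(w \x w)%E]_p (f p.1 * g p.2) = \int[w]_x f x * \int[w]_x g x.
Proof.
move=> fi gi; rewrite -RintegralZr//; congr fine.
rewrite -(integral12_prod_meas1 (f := EFin \o (fun p => f p.1 * g p.2))); last first.
  exact: integrable_tensor.
apply: eq_integral => x _; rewrite /fubini_F /=.
under eq_integral do rewrite EFinM.
by rewrite integralZl// EFinM /Rintegral fineK//; exact: (integrable_fin_num measurableT gi).
Qed.

(** The hypothesis bears on the tensor square only. A nonzero [z] is proportional to a section of
    it, hence measurable; by Tonelli the square of the integral of [|z|] is finite. *)
Lemma tensor_sq_integrable (z : T -> R) :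
  tensor_sq z \in Lfun (w \x w)%E 2%:E -> w.-integrable setT (EFin \o z).
Proof.
move=> zL.
have mzz : measurable_fun setT (tensor_sq z : T * T -> R).
  by move: zL; rewrite inE => /andP[]; rewrite inE.
have izz : (w \x w)%E.-integrable setT (EFin \o tensor_sq z).
  apply/Lfun1_integrable; apply: Lfun_subset12 zL.
  by rewrite ge0_fin_numE//; exact: product_measure_fin.
have [[x0 zx0]|z0] := pselect (exists x, z x != 0); last first.
  have -> : z = fun=> 0.
    by apply/funext => x; apply/eqP/negPn/negP => zx; apply: z0; exists x.
  exact: integrable0.
have mz : measurable_fun setT z.
  have -> : z = fun y => (z x0)^-1 * tensor_sq z (x0, y).
    by apply/funext => y; rewrite /tensor_sq /= mulrA mulVf// mul1r.
  by apply: measurable_funM; [exact: measurable_cst|exact: measurable_fun_pair2].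
have mabs : measurable_fun setT (fun x => `|(z x)%:E|%E).
  by do 2 apply: measurableT_comp => //.
apply/integrableP; split; first exact/measurable_EFinP.
have /integrable12ltyP := izz.
move=> /(_ (measurable_int _ izz)).
under eq_integral => x _.
  under eq_integral do rewrite /tensor_sq /= normrM EFinM.
  rewrite ge0_integralZl//.
  over.
rewrite ge0_integralZr//; last by apply: integral_ge0.
set I := (\int[w]_x `|_|)%E => II.
have I0 : (0 <= I)%E by apply: integral_ge0.
rewrite ltNge leye_eq; apply/negP => /eqP Ioo.
by move: II; rewrite -[X in (X * _)%E]/I Ioo mulyy ltxx.
Qed.

End product_integral.

Lemma quad_integral (R : realType) d (T : measurableType d)
    (mu : {measure set T -> \bar R}) (s : seq (R * nat * nat))
    (F : nat -> nat -> T -> R) :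
  (forall i j, mu.-integrable setT (EFin \o F i j)) ->
  mu.-integrable setT (EFin \o (fun x => quad R s (fun i j => F i j x))) /\
  \int[mu]_x quad R s (fun i j => F i j x) = quad R s (fun i j => \int[mu]_x F i j x).
Proof.
move=> iF; elim: s => [|p s [IHi IH]].
  rewrite /quad big_nil; split.
    by rewrite (_ : _ \o _ = cst 0%E); [exact: integrable0|apply/funext => x /=; rewrite big_nil].
  under eq_Rintegral do rewrite big_nil.
  by rewrite /Rintegral integral0.
have qE K : quad R (p :: s) K = p.1.1 * K p.1.2 p.2 + quad R s K.
  by rewrite /quad big_cons.
have ip : mu.-integrable setT (EFin \o (fun x => p.1.1 * F p.1.2 p.2 x)).
  have := integrableZl measurableT p.1.1 (iF p.1.2 p.2).
  by apply: eq_integrable => // x _.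
split.
  have := integrableD measurableT ip IHi.
  by apply: eq_integrable => // x _; rewrite /= qE EFinD.
under eq_Rintegral do rewrite qE.
by rewrite RintegralD// RintegralZl// IH qE.
Qed.

(** * Bump kernels *)

Lemma integrable_integral_exists (R : realType) d (T : measurableType d)
    (mu : {measure set T -> \bar R}) (f : T -> R) :
  mu.-integrable setT (EFin \o f) -> integral_exists mu (fun x => (f x)%:E).
Proof.
move=> fi; rewrite /integral_exists fin_num_adde_defr//.
by apply: integrable_fin_num => //; exact: integrable_funepos.
Qed.

Lemma bounded_mul_integrable (R : realType) d (T : measurableType d)
    (mu : {measure set T -> \bar R}) (h z : T -> R) :
  measurable_fun setT h -> bounded_real h -> mu.-integrable setT (EFin \o z) ->
  mu.-integrable setT (EFin \o (fun x => h x * z x)).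
Proof.
move=> mh [M hM] zi.
have mz : measurable_fun setT z by apply/measurable_EFinP; exact: measurable_int zi.
apply: (le_integrable measurableT _ _ (integrableZl measurableT M zi)).
  by apply/measurable_EFinP; exact: measurable_funM.
move=> x _; rewrite /= lee_fin !normrM ler_wpM2r//.
exact: le_trans (hM x) (ler_norm _).
Qed.

Section bumps.
Variables (R : realType) (X : pmetricType R)
  (w : {finite_measure set (borel X) -> \bar R}).
Hypothesis hw : positive_measure w.
Variable de : R.
Hypothesis de0 : 0 < de.

Definition bump (x y : X) : R := Num.max 0 (de - mdist x y).

Lemma bump_ge0 x y : 0 <= bump x y.
Proof. by rewrite /bump le_max lexx. Qed.

Lemma bump_bounded x : bounded_real (bump x).
Proof.
exists de => y; rewrite ger0_norm ?bump_ge0// /bump ge_max ltW//=.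
by rewrite gerBl mdist_ge0.
Qed.

Lemma bump_continuous x : continuous (bump x).
Proof.
move=> y; apply: (@continuous_max _ _ (fun=> 0) (fun y => de - mdist x y)).
  exact: cvg_cst.
by apply: cvgB; [exact: cvg_cst|exact: mdist_continuous].
Qed.

Lemma bump_support x y : bump x y != 0 -> ball x de y.
Proof.
rewrite ballEmdist /= /bump; apply: contraR; rewrite -leNgt => h.
by apply/eqP/max_idPl; rewrite subr_le0.
Qed.

Lemma bump_integrable x : w.-integrable setT (EFin \o bump x).
Proof.
apply: bounded_integrable; last exact: bump_bounded.
by apply: continuous_borel_measurable; exact: bump_continuous.
Qed.

(** The bump is at least [de / 2] on the ball of radius [de / 2], which [w] charges. *)
Lemma bump_integral_gt0 x : 0 < \int[w]_y bump x y.
Proof.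
have d20 : 0 < de / 2 by rewrite divr_gt0.
have mb := ball_measurable _ _ x (de / 2).
have wb : (0 < w (ball x (de / 2)))%E by exact: ball_measure_gt0.
have wfin : w (ball x (de / 2)) \is a fin_num by exact: fin_num_measure.
apply: (@lt_le_trans _ _ (de / 2 * fine (w (ball x (de / 2))))).
  by rewrite mulr_gt0// fine_gt0// wb ltey_eq wfin.
have mi : measurable_fun setT (\1_(ball x (de / 2)) : borel X -> R).
  exact: measurable_indic.
have bi : bounded_real (\1_(ball x (de / 2)) : borel X -> R).
  by exists 1 => y; rewrite indicE; case: (_ \in _); rewrite ?normr1 ?normr0.
have iE : \int[w]_y (\1_(ball x (de / 2)) y : R) = fine (w (ball x (de / 2))).
  by rewrite /Rintegral integral_indic// setIT.
rewrite -iE -RintegralZl//; last exact: bounded_integrable.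
apply: le_Rintegral => //.
- apply: bounded_integrable.
    by apply: measurable_funM => //; exact: measurable_cst.
  by apply: bounded_real_mul => //; exact: bounded_real_cst.
- exact: bump_integrable.
move=> y _; rewrite indicE; have [|_] := boolP (y \in _); last first.
  by rewrite mulr0 bump_ge0.
rewrite inE ballEmdist /= mulr1 => xy.
by rewrite /bump le_max; apply/orP; right; lra.
Qed.

Definition nbump (x y : X) : R := bump x y / \int[w]_y bump x y.

Lemma nbump_ge0 x y : 0 <= nbump x y.
Proof. by rewrite divr_ge0 ?bump_ge0// ltW// bump_integral_gt0. Qed.

Lemma nbump_bounded x : bounded_real (nbump x).
Proof. by apply: bounded_real_mul; [exact: bump_bounded|exact: bounded_real_cst]. Qed.

Lemma nbump_continuous x : continuous (nbump x).
Proof. by move=> y; apply: cvgM; [exact: bump_continuous|exact: cvg_cst]. Qed.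

Lemma nbump_measurable x : measurable_fun setT (nbump x : borel X -> R).
Proof. by apply: continuous_borel_measurable; exact: nbump_continuous. Qed.

Lemma nbump_support x y : nbump x y != 0 -> ball x de y.
Proof.
by move=> h; apply: bump_support; apply: contra_neq h => h; rewrite /nbump h mul0r.
Qed.

Lemma nbump_integrable x : w.-integrable setT (EFin \o nbump x).
Proof.
by apply: bounded_integrable; [exact: nbump_measurable|exact: nbump_bounded].
Qed.

Lemma nbump_integral x : \int[w]_y nbump x y = 1.
Proof.
rewrite RintegralZr//; last exact: bump_integrable.
by rewrite divff// gt_eqF// bump_integral_gt0.
Qed.

(** Symmetrised, since the gap inequalities test symmetric kernels; the factor 1/2 keeps the
    integral equal to 1. *)
Definition bump_prod (q : nat -> X) (i j : nat) (p : X * X) : R :=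
  (nbump (q i) p.1 * nbump (q j) p.2 + nbump (q j) p.1 * nbump (q i) p.2) / 2.

Lemma bump_prod_ge0 q i j p : 0 <= bump_prod q i j p.
Proof. by rewrite divr_ge0// addr_ge0// mulr_ge0// nbump_ge0. Qed.

Lemma bump_prod_sym q i j : symmetric_kernel (bump_prod q i j).
Proof. by move=> x y; rewrite /bump_prod /=; congr (_ / 2); ring. Qed.

Lemma bump_prod_bounded q i j : bounded_real (bump_prod q i j).
Proof.
have b k l : bounded_real (fun p : X * X => nbump (q k) p.1 * nbump (q l) p.2).
  have [M kM] := nbump_bounded (q k); have [N lN] := nbump_bounded (q l).
  by exists (M * N) => p; rewrite normrM ler_pM.
apply: bounded_real_mul; last exact: bounded_real_cst.
have := bounded_real_lin _ _ _ _ 1 (b i j) (b j i).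
by congr bounded_real; apply/funext => p; rewrite mul1r.
Qed.

Lemma bump_prod_continuous q i j : continuous (bump_prod q i j).
Proof.
have c k l : continuous (fun p : X * X => nbump (q k) p.1 * nbump (q l) p.2).
  move=> p; apply: cvgM.
    by apply: continuous_comp; [exact: cvg_fst|exact: nbump_continuous].
  by apply: continuous_comp; [exact: cvg_snd|exact: nbump_continuous].
move=> p; apply: cvgM; last exact: cvg_cst.
by apply: cvgD; exact: c.
Qed.

Lemma bump_prod_integral q i j :
  (w \x w)%E.-integrable setT (EFin \o bump_prod q i j) /\
  \int[(w \x w)%E]_p bump_prod q i j p = 1.
Proof.
have int_ k l : (w \x w)%E.-integrable setT
    (EFin \o (fun p : borel X * borel X => nbump (q k) p.1 * nbump (q l) p.2)).
  by apply: integrable_tensor; exact: nbump_integrable.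
have sum_i := integrableD measurableT (int_ i j) (int_ j i).
have := integrableZr measurableT 2^-1 sum_i.
split; first by [].
rewrite RintegralZr// RintegralD//.
rewrite !Rintegral_tensor ?nbump_integral//; try exact: nbump_integrable.
by rewrite mulr1 divff.
Qed.

(** Against a tensor square both halves of the kernel give the same product of two weighted averages
    of [z]. *)
Lemma bump_prod_tensor q i j (z : X -> R) :
  w.-integrable setT (EFin \o z) ->
  (w \x w)%E.-integrable setT (EFin \o (fun p => bump_prod q i j p * tensor_sq z p)) /\
  \int[(w \x w)%E]_p (bump_prod q i j p * tensor_sq z p) =
    (\int[w]_x (nbump (q i) x * z x)) * (\int[w]_x (nbump (q j) x * z x)).
Proof.
move=> zi; pose hz k x := nbump (q k) x * z x.
have ihz k : w.-integrable setT (EFin \o hz k).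
  by apply: bounded_mul_integrable => //; [exact: nbump_measurable|exact: nbump_bounded].
have E p : bump_prod q i j p * tensor_sq z p =
    (hz i p.1 * hz j p.2 + hz j p.1 * hz i p.2) / 2.
  by rewrite /bump_prod /tensor_sq /hz; ring.
have int_ k l : (w \x w)%E.-integrable setT
    (EFin \o (fun p : borel X * borel X => hz k p.1 * hz l p.2)).
  exact: integrable_tensor.
have sum_i : (w \x w)%E.-integrable setT (EFin \o (fun p : borel X * borel X =>
    hz i p.1 * hz j p.2 + hz j p.1 * hz i p.2)).
  by apply: eq_integrable (integrableD measurableT (int_ i j) (int_ j i)) => // p _; rewrite /= EFinD.
under eq_Rintegral do rewrite E.
split.
  apply: eq_integrable (integrableZr measurableT 2^-1 sum_i) => // p _.
  by rewrite /= E.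
rewrite RintegralZr// RintegralD// !Rintegral_tensor// -/(hz i) -/(hz j).
by field.
Qed.

End bumps.

(** The test kernel [lam] replaces each term of [s] by a product of narrow bumps. Its form at an
    [E]-valued [z] is [quad] at averages of [z], which stay in [E], so its gap is nonnegative; its
    integral against [rho] is close to [quad] at the values of [rho]. *)
Lemma gap_quad_pos (R : realType) (X : pmetricType R)
    (w : {finite_measure set (borel X) -> \bar R}) (E : set R) (rho : X * X -> R)
    (q : nat -> X) (s : seq (R * nat * nat)) :
  positive_measure w -> sign_cone R E -> continuous rho ->
  symmetric_kernel rho -> gap_inequalities E (w \x w)%E rho ->
  (forall v : nat -> R, (forall i, E (v i)) -> 0 <= quad R s (fun i j => v i * v j)) ->
  0 <= quad R s (fun i j => rho (q i, q j)).
Proof.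
move=> hw hE crho srho hgap spos.
(* This gives the measurability of continuous kernels on the product. *)
have [dq dqP] := dense_sequence _ _ _ hw.
have near_rho (e : R) : 0 < e -> exists2 de, 0 < de & forall p, p \in s -> forall x y,
    ball (q p.1.2) de x -> ball (q p.2) de y ->
    `|rho (x, y) - rho (q p.1.2, q p.2)| <= e.
  elim: s {spos} => [|p s IH] e10; first by exists 1.
  have [d1 d10 d1P] := IH e10.
  have /cvgrPdist_le/(_ _ e10)[[A B] /= [nA nB] AB] := crho (q p.1.2, q p.2).
  have /nbhs_ballP[rA /= rA0 hA] := nA; have /nbhs_ballP[rB /= rB0 hB] := nB.
  exists (Num.min d1 (Num.min rA rB)); first by rewrite !lt_min d10 rA0.
  move=> p'; rewrite inE => /predU1P[->|p's] x y xb yb.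
    rewrite distrC; apply: (AB (x, y)); split=> /=.
      by apply: hA; apply: le_ball xb; rewrite !ge_min lexx !orbT.
    by apply: hB; apply: le_ball yb; rewrite !ge_min lexx !orbT.
  by apply: d1P => //; [apply: le_ball xb|apply: le_ball yb]; rewrite ge_min lexx.
apply/ler_addgt0Pl => e e0.
(* An error [e / C] in each term adds up to at most [e]; the 1 keeps [C] positive. *)
pose C := 1 + \sum_(p <- s) `|p.1.1|.
have C0 : 0 < C by rewrite ltr_pwDl// sumr_ge0.
have e10 : 0 < e / C by rewrite divr_gt0.
have [de de0 deP] := near_rho _ e10.
pose B i j := bump_prod R X w de q i j.
pose lam p := quad R s (fun i j => B i j p).
have iB i j := (bump_prod_integral _ _ w hw de de0 q i j).1.
have lamc : continuous lam.
  move=> p; rewrite /lam /quad; elim: (s) => [|a s' IH].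
    rewrite (_ : (fun p => _) = fun=> 0); last by apply/funext => x; rewrite big_nil.
    exact: cvg_cst.
  rewrite (_ : (fun p => _) = fun p => a.1.1 * B a.1.2 a.2 p +
    \sum_(p0 <- s') p0.1.1 * B p0.1.2 p0.2 p); last first.
    by apply/funext => x; rewrite big_cons.
  by apply: cvgD => //; apply: cvgM; [exact: cvg_cst|exact: bump_prod_continuous].
have lams : symmetric_kernel lam.
  by move=> x y; apply: eq_bigr => p _; congr (_ * _); exact: bump_prod_sym.
have lamb : bounded_real lam.
  rewrite /lam /quad; elim: (s) => [|a s' [M IH]].
    by exists 0 => x; rewrite big_nil normr0.
  have [N BN] : bounded_real (B a.1.2 a.2) by exact: bump_prod_bounded.
  exists (`|a.1.1| * N + M) => x; rewrite big_cons (le_trans (ler_normD _ _))//.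
  by rewrite lerD// normrM ler_wpM2l.
have lamm : measurable_fun setT (lam : borel X * borel X -> R).
  exact: continuous_kernel_measurable dqP _ lamc.
have lamL : (lam : borel X * borel X -> R) \in Lfun (w \x w)%E 2%:E.
  apply: integrable_sqr_Lfun2 => //; apply: bounded_integrable_fin.
  - exact: product_measure_fin.
  - exact: measurable_funX.
  - by have := bounded_real_mul _ _ _ _ lamb lamb; congr bounded_real.
(* The symmetrised kernel also charges points near [(q a.2, q a.1)]; there the symmetry of [rho]
   gives the same estimate. *)
have Brho a : a \in s -> forall p,
    B a.1.2 a.2 p * `|rho p - rho (q a.1.2, q a.2)| <= e / C * B a.1.2 a.2 p.
  move=> as_ [x y]; have b0 u v : 0 <= nbump _ _ w de u v by exact: nbump_ge0.
  have supp u v : nbump _ _ w de u v = 0 \/ ball u de v.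
    have [->|/nbump_support] := eqVneq (nbump _ _ w de u v) 0; first by left.
    by right.
  have halfB u v : nbump _ _ w de (q a.1.2) u * nbump _ _ w de (q a.2) v *
      `|rho (u, v) - rho (q a.1.2, q a.2)| <=
      e / C * (nbump _ _ w de (q a.1.2) u * nbump _ _ w de (q a.2) v).
    have [->|bu] := supp (q a.1.2) u; first by rewrite !mul0r mulr0.
    have [->|bv] := supp (q a.2) v; first by rewrite mulr0 mul0r mulr0.
    rewrite [leRHS]mulrC (ler_wpM2l (mulr_ge0 (b0 _ _) (b0 _ _)))//; exact: deP.
  have h1 := halfB x y; have h2 := halfB y x; rewrite (srho y x) in h2.
  rewrite /B /bump_prod /=; move: h1 h2; set r := `|_|; set k := e / C; nra.
pose sabs : seq (R * nat * nat) := [seq (`|a.1.1|, a.1.2, a.2) | a <- s].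
have B0 i j p : 0 <= B i j p by exact: bump_prod_ge0.
have iBc i j (c : R) : (w \x w)%E.-integrable setT (EFin \o (fun p => B i j p * c)).
  by apply: eq_integrable (integrableZr measurableT c (iB i j)) => // p _.
have IBc i j (c : R) : \int[(w \x w)%E]_p (B i j p * c) = c.
  rewrite RintegralZr//.
  by rewrite (bump_prod_integral _ _ w hw de de0 q i j).2 mul1r.
(* [rho] may be unbounded, but where a bump product is nonzero it is within [e / C] of a fixed
   value. *)
have ilamrho : (w \x w)%E.-integrable setT
    (EFin \o (fun p : borel X * borel X => lam p * rho p)).
  have [iG _] := quad_integral _ _ _ (w \x w)%E sabs _
    (fun i j => iBc i j (`|rho (q i, q j)| + e / C)).
  apply: (le_integrable measurableT _ _ iG).
    apply/measurable_EFinP; apply: measurable_funM => //.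
    exact: continuous_kernel_measurable dqP _ crho.
  move=> p _; rewrite /= lee_fin /lam /quad mulr_suml.
  rewrite (le_trans (ler_norm_sum _ _ _))// (le_trans _ (ler_norm _))//.
  rewrite big_map big_seq [leRHS]big_seq; apply: ler_sum => a as_ /=.
  rewrite -mulrA normrM ler_wpM2l// normrM (ger0_norm (B0 _ _ _)).
  rewrite mulrDr [X in _ + X]mulrC; apply: le_trans (lerD (lexx _) (Brho a as_ p)).
  rewrite -mulrDr ler_wpM2l//.
  rewrite -[in leLHS](subrK (rho (q a.1.2, q a.2)) (rho p)) addrC.
  exact: ler_normD.
have gap0 : (0 <= gap (lam : borel X * borel X -> R) E (w \x w))%E.
  apply: le_ereal_inf_tmp => _ [z [zE zL] <-].
  have zi := tensor_sq_integrable _ _ _ _ _ zL.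
  pose v i := \int[w]_x (nbump _ _ w de (q i) x * z x).
  have zB i j := bump_prod_tensor _ _ w de de0 q i j z zi.
  have [iq qE] := quad_integral _ _ _ _ s _ (fun i j => (zB i j).1).
  have lamz p : lam p * tensor_sq z p =
      quad R s (fun i j => B i j p * tensor_sq z p).
    by rewrite /lam /quad mulr_suml; apply: eq_bigr => a _; rewrite mulrA.
  under eq_integral do rewrite lamz.
  rewrite -(fineK (integrable_fin_num measurableT iq)) lee_fin.
  rewrite [X in _ <= X]qE (_ : quad _ _ _ = quad R s (fun i j => v i * v j)); last first.
    by apply: eq_bigr => a _; rewrite (zB _ _).2.
  apply: spos => i; rewrite /v.
  have b0 x : 0 <= nbump _ _ w de (q i) x by exact: nbump_ge0.
  case: hE zE => -> //= zE.
    by apply: Rintegral_ge0 => x _; apply: mulr_ge0 => //; exact: zE.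
  rewrite -oppr_ge0 -mulN1r -RintegralZl//; last first.
    by apply: bounded_mul_integrable => //; [exact: nbump_measurable|exact: nbump_bounded].
  apply: Rintegral_ge0 => x _; rewrite mulN1r oppr_ge0.
  by apply: mulr_ge0_le0 => //; exact: zE.
have := le_trans gap0 (hgap lam lamc lams lamL (integrable_integral_exists _ _ _ _ _ ilamrho)).
rewrite -(fineK (integrable_fin_num measurableT ilamrho)) lee_fin => /le_trans; apply.
have [i1 I1] := quad_integral _ _ _ (w \x w)%E s _ (fun i j => iBc i j (rho (q i, q j))).
have [i2 I2] := quad_integral _ _ _ (w \x w)%E sabs _ (fun i j => iBc i j (e / C)).
apply: (@le_trans _ _ (\int[(w \x w)%E]_p (quad R s (fun i j => B i j p * rho (q i, q j)) +
   quad R sabs (fun i j => B i j p * (e / C))))).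
  apply: le_Rintegral => //.
    by apply: eq_integrable (integrableD measurableT i1 i2) => // p _; rewrite /= EFinD.
  move=> p _; rewrite /lam /quad big_map /= mulr_suml -big_split /=.
  rewrite big_seq [leRHS]big_seq; apply: ler_sum => a as_.
  rewrite -mulrA -lerBlDl -mulrBr -mulrBr (le_trans (ler_norm _))// normrM.
  rewrite ler_wpM2l// normrM (ger0_norm (B0 _ _ _)) [leRHS]mulrC.
  exact: Brho.
rewrite RintegralD// I1 I2.
have -> : quad R s (fun i j => \int[(w \x w)%E]_p (B i j p * rho (q i, q j))) =
    quad R s (fun i j => rho (q i, q j)).
  by apply: eq_bigr => a _; rewrite IBc.
rewrite [leRHS]addrC lerD2l /quad big_map /=.
under eq_bigr do rewrite IBc.
rewrite -mulr_suml mulrA ler_pdivrMr// mulrC ler_wpM2l ?ltW//.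
by rewrite /C ltrDr.
Qed.

(** * Covariances satisfy the gap inequalities *)

(** The form at [rho] is the mean of the form at the random vector of the [Z (q i)], whose values
    lie in [E]. *)
Lemma covariance_quad_ge0 (R : realType) (X : Type) (E : set R)
    (d : measure_display) (O : measurableType d) (P : probability O R)
    (Z : X -> {RV P >-> R}) (rho : X * X -> R) (q : nat -> X)
    (s : seq (R * nat * nat)) :
  random_field E Z -> noncentered_covariance Z rho ->
  (forall v : nat -> R, (forall i, E (v i)) -> 0 <= quad R s (fun i j => v i * v j)) ->
  0 <= quad R s (fun i j => rho (q i, q j)).
Proof.
move=> ZE [ZL Zrho] spos.
have iZZ i j : P.-integrable setT (EFin \o (fun o => Z (q i) o * Z (q j) o)).
  by apply/Lfun1_integrable; exact: Lfun2_mul_Lfun1.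
have [_ I] := quad_integral _ _ _ P s _ iZZ.
rewrite (_ : quad _ _ _ = quad R s (fun i j =>
    \int[P]_o (Z (q i) o * Z (q j) o))); last first.
  apply: eq_bigr => p _.
  by have := Zrho (q p.1.2) (q p.2); rewrite unlock /= /Rintegral => ->.
by rewrite -I; apply: Rintegral_ge0 => o _; apply: spos => i; exact: ZE.
Qed.

(** The squares of [Z x + Z y] and [Z x - Z y] have nonnegative means. A bound on the diagonal of
    [rho] thus bounds [rho]. *)
Lemma covariance_norm_le (R : realType) (X : Type) (E : set R)
    (d : measure_display) (O : measurableType d) (P : probability O R)
    (Z : X -> {RV P >-> R}) (rho : X * X -> R) (x y : X) :
  random_field E Z -> noncentered_covariance Z rho ->
  2 * `|rho (x, y)| <= rho (x, x) + rho (y, y).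
Proof.
move=> ZE Zrho.
have h c : c ^+ 2 = 1 -> 0 <= rho (x, x) + rho (y, y) + 2 * c * rho (x, y).
  move=> c2; pose q i := if i is 0 then x else y.
  have := covariance_quad_ge0 _ _ _ _ _ P Z rho q
    [:: (1, 0, 0); (1, 1, 1); (2 * c, 0, 1)] ZE Zrho.
  rewrite /quad !big_cons !big_nil /= !mul1r addr0 addrA; apply => v _.
  rewrite !big_cons !big_nil /=.
  have -> : 1 * (v 0 * v 0) + (1 * (v 1 * v 1) + (2 * c * (v 0 * v 1) + 0)) =
    (v 0 + c * v 1) ^+ 2 + (1 - c ^+ 2) * v 1 ^+ 2 by ring.
  by rewrite c2 subrr mul0r addr0 sqr_ge0.
have /h h1 : 1 ^+ 2 = 1 :> R by rewrite expr1n.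
have /h h2 : (-1) ^+ 2 = 1 :> R by rewrite sqrrN expr1n.
by case: (ger0P (rho (x, y))) => _; lra.
Qed.

(** * Truncated and discretised kernels *)

Section truncated_positivity.
Variables (R : realType) (X : pmetricType R)
  (w : {finite_measure set (borel X) -> \bar R}) (E : set R) (q : nat -> X)
  (lam : X * X -> R).
Hypothesis dq : forall (x : X) (A : set X), nbhs x A -> exists n, A (q n).
Hypothesis hE : sign_cone R E.
Hypothesis clam : continuous lam.
Hypothesis lamL : (lam : borel X * borel X -> R) \in Lfun (w \x w)%E 2%:E.
Hypothesis lam_pos : forall z : X -> R, (forall x, E (z x)) ->
  tensor_sq (z : borel X -> R) \in Lfun (w \x w)%E 2%:E ->
  0 <= \int[(w \x w)%E]_p (lam p * tensor_sq z p).

Let mlam : measurable_fun setT (lam : borel X * borel X -> R).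
Proof. exact: continuous_kernel_measurable dq _ clam. Qed.

Let ilam : (w \x w)%E.-integrable setT (EFin \o (lam : borel X * borel X -> R)).
Proof.
apply/Lfun1_integrable; apply: Lfun_subset12 lamL.
by rewrite ge0_fin_numE//; exact: product_measure_fin.
Qed.

Variables (A : set X) (m : nat).
Hypothesis oA : open A.

Let mA : measurable (A : set (borel X)).
Proof. exact: sub_sigma_algebra. Qed.

Let idx := near_idx R X q m.
Let b i : R := \1_A (q i).

(** The indicators ask that both the points of [p] and their nearest dense points lie in [A]: [A]
    will be a set on which [rho] is bounded, and [K] is read at the nearest points. *)
Definition trunc_kernel (K : nat -> nat -> R) (p : X * X) : R :=
  lam p * (\1_A p.1 * \1_A p.2 * (b (idx p.1) * b (idx p.2) * K (idx p.1) (idx p.2))).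

Let mind (B : set X) : measurable (B : set (borel X)) ->
  measurable_fun setT (fun p : borel X * borel X => \1_B p.1 : R) /\
  measurable_fun setT (fun p : borel X * borel X => \1_B p.2 : R).
Proof.
move=> mB; have mi : measurable_fun setT (\1_B : borel X -> R) by exact: measurable_indic.
by split; [exact: (measurableT_comp mi)|exact: (measurableT_comp mi)].
Qed.

Let ind01 (B : set X) x : 0 <= (\1_B x : R) <= 1.
Proof. by rewrite indicE; case: (_ \in _); rewrite ?lexx ?ler01. Qed.

Lemma trunc_kernel_measurable K :
  measurable_fun setT (trunc_kernel K : borel X * borel X -> R).
Proof.
apply: measurable_funM => //; apply: measurable_funM.
  by apply: measurable_funM; [exact: (mind _ mA).1|exact: (mind _ mA).2].
exact: (measurable_near_kernel _ _ q m (fun i j => b i * b j * K i j)).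
Qed.

(** For such a product matrix the factor of [lam] is the tensor square of an [E]-valued function
    with finitely many values. *)
Lemma trunc_kernel_vec_ge0 (v : nat -> R) : (forall i, E (v i)) ->
  0 <= \int[(w \x w)%E]_p trunc_kernel (fun i j => v i * v j) p.
Proof.
move=> vE; pose z x := \1_A x * b (idx x) * v (idx x).
have zE x : E (z x).
  apply: sign_coneZ => //; apply: mulr_ge0.
    by have /andP[] := ind01 A x.
  by have /andP[] := ind01 A (q (idx x)).
have := lam_pos z zE.
rewrite (_ : (fun p => lam p * tensor_sq z p) =
    trunc_kernel (fun i j => v i * v j)); last first.
  by apply/funext => p; rewrite /trunc_kernel /tensor_sq /z; ring.
apply.
have mz : measurable_fun setT (tensor_sq z : borel X * borel X -> R).
  rewrite (_ : tensor_sq z = fun p => \1_A p.1 * \1_A p.2 *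
     (b (idx p.1) * b (idx p.2) * (v (idx p.1) * v (idx p.2)))).
    apply: measurable_funM.
      by apply: measurable_funM; [exact: (mind _ mA).1|exact: (mind _ mA).2].
    exact: (measurable_near_kernel _ _ q m (fun i j => b i * b j * (v i * v j))).
  by apply/funext => p; rewrite /tensor_sq /z; ring.
have bz : bounded_real z.
  exists (\sum_(i < m.+1) `|v i|) => x; rewrite normrM.
  have h : `|\1_A x * b (idx x)| <= 1.
    rewrite normrM; have /andP[h1 h2] := ind01 A x.
    have /andP[h3 h4] := ind01 A (q (idx x)).
    by rewrite !ger0_norm// mulr_ile1.
  apply: le_trans (ler_wpM2r (normr_ge0 _) h) _; rewrite mul1r.
  rewrite (bigD1 (Ordinal (near_idx_le _ _ q m x))) //= lerDl.
  exact: sumr_ge0.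
have bzz : bounded_real (tensor_sq z).
  have [M zM] := bz; exists (M * M) => p.
  by rewrite /tensor_sq normrM ler_pM.
apply: integrable_sqr_Lfun2 => //; apply: bounded_integrable_fin.
- exact: product_measure_fin.
- exact: measurable_funX.
- by have := bounded_real_mul _ _ _ _ bzz bzz; congr bounded_real.
Qed.

(* Only finitely many values of [K] enter, and linearly: the integral of the
   truncated kernel is a quadratic form evaluated at [K]. *)
Lemma trunc_kernel_quad : exists s : seq (R * nat * nat), forall K,
  \int[(w \x w)%E]_p trunc_kernel K p = quad R s K.
Proof.
pose G i j (p : X * X) : R := lam p * (\1_A p.1 * \1_A p.2) *
  (\1_(near_cell R X q m i) p.1 * \1_(near_cell R X q m j) p.2).
have iG i j : (w \x w)%E.-integrable setT (EFin \o (G i j : borel X * borel X -> R)).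
  have mi := mind _ (measurable_near_cell _ _ q m i).
  have mj := mind _ (measurable_near_cell _ _ q m j).
  apply: (le_integrable measurableT _ _ ilam).
    apply/measurable_EFinP; apply: measurable_funM.
      apply: measurable_funM => //.
      by apply: measurable_funM; [exact: (mind _ mA).1|exact: (mind _ mA).2].
    by apply: measurable_funM; [exact: mi.1|exact: mj.2].
  move=> p _; rewrite /= lee_fin /G -mulrA normrM -[leRHS]mulr1 ler_wpM2l//.
  have /andP[a1 a2] := ind01 A p.1; have /andP[a3 a4] := ind01 A p.2.
  have /andP[a5 a6] := ind01 (near_cell R X q m i) p.1.
  have /andP[a7 a8] := ind01 (near_cell R X q m j) p.2.
  by rewrite ger0_norm ?mulr_ge0// !mulr_ile1 ?mulr_ge0.
pose s0 : seq (R * nat * nat) :=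
  [seq (1, i, j) | i <- index_iota 0 m.+1, j <- index_iota 0 m.+1].
exists [seq (\int[(w \x w)%E]_p G a.1.2 a.2 p * (b a.1.2 * b a.2), a.1.2, a.2)
  | a <- s0] => K.
have iGK i j : (w \x w)%E.-integrable setT
    (EFin \o (fun p : borel X * borel X => G i j p * (b i * b j * K i j))).
  by apply: eq_integrable (integrableZr measurableT (b i * b j * K i j) (iG i j)) => // p _.
have [_ I] := quad_integral _ _ _ (w \x w)%E s0 _ iGK.
transitivity (\int[(w \x w)%E]_p quad R s0 (fun i j => G i j p * (b i * b j * K i j))).
  apply: eq_Rintegral => -[x y] _; rewrite /quad big_allpairs_dep /=.
  under eq_bigr do rewrite big_mkord.
  rewrite big_mkord /trunc_kernel /=.
  have sE (f : nat -> R) : \sum_(i < m.+1) f i * \1_(near_cell R X q m i) x = f (idx x).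
    exact: near_cell_sum.
  have sE' (f : nat -> R) : \sum_(i < m.+1) f i * \1_(near_cell R X q m i) y = f (idx y).
    exact: near_cell_sum.
  rewrite -(sE (fun i => b i * b (idx y) * K i (idx y))) !mulr_sumr.
  apply: eq_bigr => i _.
  rewrite -(sE' (fun j => b i * b j * K i j)) mulr_suml !mulr_sumr.
  by apply: eq_bigr => j _; rewrite /G /=; ring.
rewrite I /quad big_map; rewrite /s0 !big_allpairs_dep /=.
apply: eq_bigr => i _; apply: eq_bigr => j _.
by rewrite mul1r RintegralZr// !mulrA.
Qed.

End truncated_positivity.

Section covariance_gap.
Variables (R : realType) (X : pmetricType R)
  (w : {finite_measure set (borel X) -> \bar R}) (E : set R) (q : nat -> X)
  (rho lam : X * X -> R).
Hypothesis dq : forall (x : X) (A : set X), nbhs x A -> exists n, A (q n).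
Hypothesis hE : sign_cone R E.
Hypothesis crho : continuous rho.
Hypothesis clam : continuous lam.
Hypothesis lamL : (lam : borel X * borel X -> R) \in Lfun (w \x w)%E 2%:E.
Hypothesis lam_pos : forall z : X -> R, (forall x, E (z x)) ->
  tensor_sq (z : borel X -> R) \in Lfun (w \x w)%E 2%:E ->
  0 <= \int[(w \x w)%E]_p (lam p * tensor_sq z p).
Variables (d : measure_display) (O : measurableType d) (P : probability O R)
  (Z : X -> {RV P >-> R}).
Hypothesis ZE : random_field E Z.
Hypothesis Zrho : noncentered_covariance Z rho.

(** These open sets increase to [X], and [rho] is bounded by [n] on the square of [A n]. *)
Let A (n : nat) : set X := [set x | rho (x, x) < n%:R].

Let oA n : open (A n).
Proof.
have c : continuous (fun x => rho (x, x)).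
  move=> x; apply: (continuous_comp (f := fun x => (x, x))); last exact: crho.
  by apply: cvg_pair; exact: cvg_id.
by move/continuousP : c => /(_ _ (@open_lt R n%:R)); apply.
Qed.

Let mAA n : measurable (A n `*` A n : set (borel X * borel X)).
Proof. by apply: measurableX; exact: sub_sigma_algebra. Qed.

Let rho_bounded n x y : A n x -> A n y -> `|rho (x, y)| <= n%:R.
Proof.
rewrite /A /= => Ax Ay.
by have := covariance_norm_le _ _ _ _ _ P Z rho x y ZE Zrho; lra.
Qed.

(** As [m] grows the discretised kernels converge to the truncation of [lam * rho], dominated by
    [|lam| * n]. Each has an integral that is a form nonnegative on [E]-valued vectors, taken at the
    covariance. *)
Lemma truncated_integral_ge0 n :
  (w \x w)%E.-integrable (A n `*` A n) (EFin \o (fun p : borel X * borel X => lam p * rho p)) /\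
  (0 <= \int[(w \x w)%E]_(p in A n `*` A n) (lam p * rho p)%:E)%E.
Proof.
pose K i j := rho (q i, q j).
pose f m (p : borel X * borel X) : \bar R :=
  (trunc_kernel R X q lam (A n) m K p)%:E.
pose g (p : borel X * borel X) : R :=
  lam p * (\1_(A n) p.1 * \1_(A n) p.2 * rho p).
have ilam : (w \x w)%E.-integrable setT (EFin \o (lam : borel X * borel X -> R)).
  apply/Lfun1_integrable; apply: Lfun_subset12 lamL.
  by rewrite ge0_fin_numE//; exact: product_measure_fin.
have mlam : measurable_fun setT (lam : borel X * borel X -> R).
  exact: continuous_kernel_measurable dq _ clam.
have mrho : measurable_fun setT (rho : borel X * borel X -> R).
  exact: continuous_kernel_measurable dq _ crho.
have mA : measurable_fun setT (\1_(A n) : borel X -> R).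
  by apply: measurable_indic; exact: sub_sigma_algebra.
have mg : measurable_fun setT g.
  apply: measurable_funM => //; apply: measurable_funM => //.
  by apply: measurable_funM; exact: (measurableT_comp mA).
have gE : EFin \o g = (fun p : borel X * borel X => (lam p * rho p)%:E) \_ (A n `*` A n).
  apply/funext => -[x y]; rewrite patchE /g /= !indicE.
  have -> : ((x, y) \in A n `*` A n) = (x \in A n) && (y \in A n).
    by apply/idP/andP; rewrite !inE.
  by case: (x \in A n); case: (y \in A n); rewrite /= ?mul1r ?mul0r ?mulr0.
have inlam : (w \x w)%E.-integrable setT
    (EFin \o (fun p : borel X * borel X => `|lam p| * n%:R)).
  have inlam : (w \x w)%E.-integrable setT
      (EFin \o (Num.norm \o (lam : borel X * borel X -> R))) by exact: integrable_norm.
  by apply: eq_integrable (integrableZr measurableT n%:R inlam) => // p _.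
have fb m p : `|trunc_kernel R X q lam (A n) m K p| <= `|lam p| * n%:R.
  case: p => x y; rewrite /trunc_kernel normrM ler_wpM2l//=.
  rewrite !indicE; set i := near_idx _ _ _ _ _; set j := near_idx _ _ _ _ _.
  have [|_] := boolP (q i \in A n); last by rewrite !mul0r mulr0 normr0.
  have [|_] := boolP (q j \in A n); last by rewrite mulr0 mul0r mulr0 normr0.
  rewrite !inE => Aj Ai; rewrite !mul1r.
  case: (x \in A n); case: (y \in A n); rewrite /= ?mul1r ?mul0r ?mulr0 ?normr0//.
  exact: rho_bounded.
have mf m : measurable_fun setT (f m).
  by apply/measurable_EFinP; exact: trunc_kernel_measurable.
have [] := @dominated_convergence _ _ _ (w \x w)%E setT measurableT f (EFin \o g)
  (fun p => (`|lam p| * n%:R)%:E).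
- exact: mf.
- exact/measurable_EFinP.
- apply: aeW => -[x y] _; apply: cvg_EFin; first exact: nearW.
  rewrite /f /g /trunc_kernel /=; apply: cvgM; first exact: cvg_cst.
  rewrite !indicE; have [|_] := boolP (x \in A n); last first.
    by rewrite !mul0r; under [X in X @ _ --> _]eq_fun do rewrite !mul0r; exact: cvg_cst.
  have [|_] := boolP (y \in A n); last first.
    rewrite mulr0 mul0r.
    by under [X in X @ _ --> _]eq_fun do rewrite mul0r; move=> _; exact: cvg_cst.
  rewrite !inE => Ay Ax; rewrite !mul1r.
  have cx := near_idx_cvg _ _ _ dq x; have cy := near_idx_cvg _ _ _ dq y.
  (* Since [A n] is open, the nearest points of [x] eventually lie in it. *)
  have nx : \forall m \near \oo, A n (q (near_idx R X q m x)).
    by apply: cx; exact: open_nbhs_nbhs.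
  have ny : \forall m \near \oo, A n (q (near_idx R X q m y)).
    by apply: cy; exact: open_nbhs_nbhs.
  have : (fun m => K (near_idx R X q m x) (near_idx R X q m y)) @ \oo --> rho (x, y).
    rewrite /K; apply: continuous_cvg; first exact: crho.
    by apply: cvg_pair.
  apply: cvg_trans; apply: near_eq_cvg; near=> m.
  have hx : A n (q (near_idx R X q m x)) by near: m.
  have hy : A n (q (near_idx R X q m y)) by near: m.
  by rewrite !indicE !mem_set// !mul1r.
- exact: inlam.
- by apply: aeW => p m _; rewrite lee_fin.
move=> ig _ cv; split.
  by apply/(integrable_mkcond _ (mAA n)); rewrite -gE.
rewrite integral_mkcond -gE.
rewrite -(cvg_lim _ cv)//; apply: lime_ge; first exact: cvgP cv.
apply: nearW => m.
have if_ : (w \x w)%E.-integrable setT (f m).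
  apply: (le_integrable measurableT _ _ inlam) => // p _.
  by rewrite /f /= lee_fin (le_trans (fb m p))// ler_norm.
have fE : (\int[(w \x w)%E]_p f m p =
    (\int[(w \x w)%E]_p trunc_kernel R X q lam (A n) m K p)%:E)%E.
  by rewrite /Rintegral fineK//; exact: (integrable_fin_num measurableT if_).
have [s sE] := trunc_kernel_quad _ _ w q lam dq clam lamL (A n) m (oA n).
rewrite [X in (_ <= X)%E]fE lee_fin sE.
apply: (covariance_quad_ge0 _ _ _ _ _ P Z rho q s ZE Zrho) => v vE.
rewrite -sE; exact: (trunc_kernel_vec_ge0 _ _ w E).
Unshelve. all: by end_near. Qed.

Let f (p : borel X * borel X) : \bar R := (lam p * rho p)%:E.

(** [f] need not be integrable, so its two parts are compared: on each truncation the negative part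
    has the smaller integral, and monotone convergence carries this to the whole space. *)
Lemma covariance_integral_ge0 : integral_exists (w \x w)%E f ->
  (0 <= \int[(w \x w)%E]_p f p)%E.
Proof.
move=> fex.
have mf : measurable_fun setT f.
  apply/measurable_EFinP; apply: measurable_funM.
    exact: continuous_kernel_measurable dq _ clam.
  exact: continuous_kernel_measurable dq _ crho.
have le_pn : (\int[(w \x w)%E]_p f^\- p <= \int[(w \x w)%E]_p f^\+ p)%E.
  have cov : \bigcup_n (A n `*` A n) = [set: borel X * borel X].
    apply/seteqP; split=> // -[x y] _.
    pose n := (Num.truncn (Num.max (rho (x, x)) (rho (y, y)))).+1.
    have nlt : Num.max (rho (x, x)) (rho (y, y)) < n%:R by exact: truncnS_gt.
    by move: nlt; rewrite gt_max => /andP[xn yn]; exists n.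
  have nd : nondecreasing_seq (fun n => A n `*` A n : set (borel X * borel X)).
    move=> m n mn; apply/subsetPset => -[x y] [/= xm ym].
    by split=> /=; [apply: lt_le_trans xm _|apply: lt_le_trans ym _]; rewrite ler_nat.
  have mfn : measurable_fun setT (f^\-)%E by exact: measurable_funeneg.
  have mfp : measurable_fun setT (f^\+)%E by exact: measurable_funepos.
  have := @ge0_nondecreasing_set_cvg_integral _ _ _
    (fun n => A n `*` A n : set (borel X * borel X)) (f^\-)%E (w \x w)%E nd mAA
    (fun n => measurable_funS measurableT (@subsetT _ _) mfn)
    (fun n x _ => funeneg_ge0 f x).
  rewrite cov => cvn; rewrite -(cvg_lim _ cvn)//.
  apply: lime_le; first exact: cvgP cvn.
  apply: nearW => n; have [fi fge] := truncated_integral_ge0 n.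
  have fpi : (w \x w)%E.-integrable (A n `*` A n) (f^\+)%E by exact: integrable_funepos.
  have fni : (w \x w)%E.-integrable (A n `*` A n) (f^\-)%E by exact: integrable_funeneg.
  apply: (@le_trans _ _ (\int[(w \x w)%E]_(p in A n `*` A n) f^\+ p)%E).
    move: fge; rewrite [X in (_ <= X)%E](integralE (w \x w)%E (A n `*` A n) f).
    by rewrite sube_ge0// (integrable_fin_num (mAA n) fni) ?orbT.
  by apply: ge0_subset_integral.
rewrite integralE; move: fex; rewrite /integral_exists.
move: le_pn; set a := (\int[_]_p f^\- p)%E; set b := (\int[_]_p f^\+ p)%E => ab ex.
have a0 : (0 <= a)%E by apply: integral_ge0.
(* If the negative part had infinite integral, so would the positive part, and the integral of [f]
   would not exist. *)
have [aoo|aoo] := eqVneq a +oo%E.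
  by move: ab ex; rewrite aoo leye_eq => /eqP ->.
by rewrite sube_ge0// ge0_fin_numE// ltey aoo ?orbT.
Qed.

End covariance_gap.

(** Scaling [z] by [t >= 0] stays in the cone and multiplies the form by [t ^+ 2]: one negative
    value sends the infimum to [-oo]. The zero function gives the upper bound 0. *)
Lemma gap_cone (R : realType) (d : measure_display) (T : measurableType d)
    (lam : T * T -> R) (E : set R) (w : {finite_measure set T -> \bar R}) :
  sign_cone R E -> lam \in Lfun (w \x w)%E 2%:E ->
  gap lam E (w \x w)%E = -oo%E \/
  ((gap lam E (w \x w)%E <= 0)%E /\
   forall z, (forall x, E (z x)) -> tensor_sq z \in Lfun (w \x w)%E 2%:E ->
   0 <= \int[(w \x w)%E]_p (lam p * tensor_sq z p)).
Proof.
move=> hE lamL.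
have ilam z : tensor_sq z \in Lfun (w \x w)%E 2%:E ->
    (w \x w)%E.-integrable setT (EFin \o (fun p => lam p * tensor_sq z p)).
  by move=> zL; apply/Lfun1_integrable; exact: Lfun2_mul_Lfun1.
have LZ z (t : R) : tensor_sq z \in Lfun (w \x w)%E 2%:E ->
    tensor_sq (fun x => t * z x) \in Lfun (w \x w)%E 2%:E.
  move=> zL; rewrite (_ : tensor_sq _ = t ^+ 2 \o* tensor_sq z).
    by apply: Lfun_scale => //; exact: ler1n.
  by apply/funext => p; rewrite /tensor_sq /=; ring.
have [[z [zE zL zneg]]|nz] := pselect (exists z, [/\ forall x, E (z x),
    tensor_sq z \in Lfun (w \x w)%E 2%:E &
    \int[(w \x w)%E]_p (lam p * tensor_sq z p) < 0]).
  left; set I := \int[_]_p _ in zneg.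
  have gapZ (t : R) : 0 <= t -> (gap lam E (w \x w)%E <= (t ^+ 2 * I)%:E)%E.
    move=> t0; apply: ereal_inf_lbound; exists (fun x => t * z x).
      by split; [move=> x; exact: sign_coneZ|exact: LZ].
    rewrite -RintegralZl//; last exact: ilam.
    have i2 := integrableZl measurableT (t ^+ 2) (ilam _ zL).
    rewrite /Rintegral fineK; last exact: (integrable_fin_num measurableT i2).
    by apply: eq_integral => p _; congr (_%:E); rewrite /tensor_sq; ring.
  move: gapZ; case: (gap _ _ _) => [r| |//] gapZ; last first.
    by have := gapZ 0 (lexx 0); rewrite leye_eq.
  (* Chosen so that [t >= 1] and [t ^+ 2 * I <= t * I = I - |r| < r]. *)
  pose t := 1 + `|r| / - I.
  have t1 : 1 <= t by rewrite lerDl divr_ge0// oppr_ge0 ltW.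
  have := gapZ t (le_trans ler01 t1); rewrite lee_fin leNgt => /negP[].
  have tI : t * I = I - `|r| by rewrite /t; field; rewrite lt_eqF.
  have t2 : t ^+ 2 * I <= t * I.
    by rewrite ler_nM2r// expr2 ler_peMl// (le_trans ler01).
  by have := ler_norm (- r); rewrite normrN; lra.
right; split.
  apply: ereal_inf_lbound; exists (fun=> 0).
    split; first by move=> _; exact: sign_cone0.
    rewrite (_ : tensor_sq _ = cst 0); last first.
      by apply/funext => p; rewrite /tensor_sq mulr0.
    apply: integrable_sqr_Lfun2; first exact: measurable_cst.
    apply: bounded_integrable_fin; first exact: product_measure_fin.
      by apply: measurable_funX; exact: measurable_cst.
    by exists 0 => p /=; rewrite expr0n normr0.
  by under eq_integral do rewrite /tensor_sq !mulr0; rewrite integral0.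
move=> z zE zL; rewrite leNgt; apply/negP => zneg; apply: nz.
by exists z.
Qed.

Theorem theorem12 (R : realType) (X : pmetricType R)
    (w : {finite_measure set (borel X) -> \bar R}) (hw : positive_measure w)
    (E : set R)
    (hE : [\/ E = setT, E = [set t : R | 0 <= t] | E = [set t : R | t <= 0]])
    (rho : X * X -> R) (hrho : continuous rho) :
  is_noncentered_covariance E rho <->
  (symmetric_kernel rho /\ gap_inequalities E (w \x w)%E rho).
Proof.
have [q dq] := dense_sequence _ _ _ hw.
split.
- move=> [d [U [P [Z [ZE Zrho]]]]]; split.
    move=> x y; apply: EFin_inj; rewrite -!(Zrho.2 _ _).
    by congr expectation; apply/funext => u; rewrite mulrC.
  move=> lam clam _ lamL fex.
  have [->|[gap_le0 lam_pos]] := gap_cone _ _ _ (lam : borel X * borel X -> R) E w hE lamL.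
    exact: leNye.
  apply: le_trans gap_le0 _.
  exact: (covariance_integral_ge0 _ _ w E q rho lam dq hE hrho clam lamL lam_pos
    _ _ P Z ZE Zrho fex).
- move=> [srho hgap].
  have Kpos s : (forall v : nat -> R, (forall i, E (v i)) ->
      0 <= quad R s (fun i j => v i * v j)) ->
      0 <= quad R s (fun i j => rho (q i, q j)).
    exact: gap_quad_pos hw hE hrho srho hgap.
  have [d [U [P [Z [ZE mZ bZ ZZ]]]]] := moment_problem _ E _ hE Kpos.
  exact: field_of_dense hE hrho dq ZE mZ bZ ZZ.
Qed.
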